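(* Let $\alpha,\beta,\rho>0$ be constants with $\alpha<1$, and let $P_{\rm e}>0$. There is a constant $c>0$, depending only on $\alpha,\beta,\rho,P_{\rm e}$, such that the following holds. Let $W$ be any BMS channel whose Bhattacharyya process $Z_n=Z(W_n)$ satisfies $$\mathbb{E}\bigl[(Z_n(1-Z_n))^\alpha\bigr]\le \beta\,2^{-\rho n}\qquad\text{for all } n\in\mathbb{N}.$$ Then for every rate $0<R<I(W)$, writing $d=I(W)-R$, there is a block-length $N=2^n$ with $$\log N\le \Bigl(1+\frac1\rho\Bigr)\log\frac1d + c\Bigl(\log\bigl(\log\tfrac{4}{d}\bigr)\Bigr)^2$$ such that the polar code for $W$ of block-length $N$ and rate $R$ has block error probability at most $P_{\rm e}$ under successive cancellation decoding.
   Context: All logarithms are base $2$; $\mathbb{N}=\{0,1,2,\dots\}$. A BMS channel $W:\{0,1\}\to\mathcal{Y}$ is a binary-input memoryless output-symmetric channel with discrete output alphabet $\mathcal{Y}$ and transition probabilities $W(y\mid x)$ (output-symmetric: there is an involution $\pi$ of $\mathcal{Y}$ with $W(y\mid 1)=W(\pi(y)\mid 0)$ for all $y$). Its capacity is $I(W)=1-H(W)$, where $H(W)=\sum_{y}W(y\mid 1)\log\frac{W(y\mid 1)+W(y\mid 0)}{W(y\mid 1)}$; its Bhattacharyya parameter is $Z(W)=\sum_y\sqrt{W(y\mid 0)W(y\mid 1)}$; its error probability is $E(W)=\sum_{y}W(y\mid 1)\bigl(\mathbf{1}_{\{W(y\mid 0)>W(y\mid 1)\}}+\tfrac12\mathbf{1}_{\{W(y\mid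 0)=W(y\mid 1)\}}\bigr)$. Channel transform $W\mapsto(W^0,W^1)$ (both BMS): $W^0(y_1,y_2\mid x_1)=\sum_{x_2\in\{0,1\}}\tfrac12 W(y_1\mid x_1\oplus x_2)W(y_2\mid x_2)$, $W^1(y_1,y_2,x_1\mid x_2)=\tfrac12 W(y_1\mid x_1\oplus x_2)W(y_2\mid x_2)$. Polarization process: with $B_1,B_2,\dots$ i.i.d. Bernoulli($\frac12$), $W_0=W$ and $W_n=W_{n-1}^{0}$ if $B_n=0$, $W_n=W_{n-1}^{1}$ if $B_n=1$. For $N=2^n$ and $0\le i\le N-1$ with binary expansion $b_1\cdots b_n$ ($b_1$ most significant), $W_N^{(i)}=(((W^{b_1})^{b_2})^{\cdots})^{b_n}$. Polar code of block-length $N=2^n$ and rate $R$: let $\mathcal{I}_{N,R}$ be the set of $NR$ (rounded up to an integer) indices $i$ with the smallest values $E(W_N^{(i)})$, ties broken arbitrarily. A vector $u\in\{0,1\}^N$ with $u_i=0$ for $i\notin\mathcal{I}_{N,R}$ and $(u_i)_{i\in\mathcal{I}_{N,R}}$ uniformly distributed information bits is encoded as $x=uG_n$ over $\mathbb{F}_2$, $G_n=\begin{bmatrix}1&0\\1&1\end{bmatrix}^{\otimes n}$ (so the generator matrix consists of the rows of $G_n$ indexed by $\mathcal{I}_{N,R}$), and $x$ is sent over $N$ independent uses of $W$, with output $y\in\mathcal{Y}^N$. Up to relabeling of outputs, $W_N^{(i)}$ is the channel from $u_i$ to $(y,u_0,\dots,u_{i-1})$ given by $2^{-(N-1)}\sum_{u_{i+1},\dots,u_{N-1}}\prod_{k}W(y_k\mid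 (uG_n)_k)$. The successive cancellation (SC) decoder computes, for $i=0,1,\dots,N-1$ in order, $\hat u_i=0$ if $i\notin\mathcal{I}_{N,R}$, and otherwise $\hat u_i$ is the value $v\in\{0,1\}$ maximizing $W_N^{(i)}(y,\hat u_0,\dots,\hat u_{i-1}\mid v)$ (ties broken by a fair coin). The block error probability is $\Pr(\hat u\ne u)$. *)

(* Defs.v *)
From HB Require Import structures.
From mathcomp Require Import all_boot all_order all_algebra.
From mathcomp Require Import all_classical all_reals all_analysis.
From mathcomp Require Import mxtens.

Set Implicit Arguments.
Unset Strict Implicit.
Unset Printing Implicit Defensive.

Import Order.TTheory GRing.Theory Num.Theory.

Local Open Scope classical_set_scope.
Local Open Scope ring_scope.

Definition log2 (R : realType) (x : R) : R := ln x / ln 2.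

(* The binary alphabet is [bool], with MathComp's structure of field with two
   elements: addition is exclusive or, multiplication is conjunction.
   A discrete alphabet is an arbitrary (finite or infinite) countable type.
   [W y x] is the transition probability W(y | x). *)
Record channel (R : realType) := Channel {
  output : countType;
  trans :> output -> bool -> R }.

Definition is_BMS (R : realType) (W : channel R) : Prop :=
  [/\ forall y x, 0 <= W y x,
      forall x, \esum_(y in [set: output W]) (W y x)%:E = 1%E
    & exists pi : output W -> output W,
        involutive pi /\ forall y, W y true = W (pi y) false].

Section Functionals.
Variables (R : realType) (W : channel R).

(* All the sums below have nonnegative terms and, for a BMS channel, a total at
   most 1, so that [fine] returns their value. *)

(* When W(y | 1) = 0, the term is 0 since it has a null factor. *)
Definition entropy : R :=
  fine (\esum_(y in [set: output W])
    (W y true * log2 ((W y true + W y false) / W y true))%:E).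

Definition capacity : R := 1 - entropy.

Definition bhattacharyya : R :=
  fine (\esum_(y in [set: output W]) (Num.sqrt (W y false * W y true))%:E).

Definition error_prob : R :=
  fine (\esum_(y in [set: output W])
    (W y true * ((W y true < W y false)%R%:R
                 + 2^-1 * (W y false == W y true)%:R))%:E).

End Functionals.

Section Transform.
Variables (R : realType) (W : channel R).

Definition minus_transform : channel R :=
  @Channel R (output W * output W)%type
    (fun y x1 => \sum_(x2 : bool) 2^-1 * W y.1 (x1 + x2) * W y.2 x2).

(* An output (y1, y2, x1) is the nested pair ((y1, y2), x1). *)
Definition plus_transform : channel R :=
  @Channel R (output W * output W * bool)%type
    (fun y x2 => 2^-1 * W y.1.1 (y.2 + x2) * W y.1.2 x2).

End Transform.

Definition transform (R : realType) (W : channel R) (b : bool) : channel R :=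
  if b then plus_transform W else minus_transform W.

Definition polarized (R : realType) (W : channel R) (s : seq bool) : channel R :=
  foldl (@transform R) W s.

(* Expectation of f(B_1, ..., B_n) for independent Bernoulli(1/2) variables
   B_1, ..., B_n, whose joint law is uniform on {0,1}^n. *)
Definition coin_expectation (R : realType) (n : nat)
    (f : n.-tuple bool -> R) : R :=
  \sum_(b : n.-tuple bool) 2 ^- n * f b.

(* The state at time n of the Bhattacharyya process Z_n = Z(W_n), as a function
   of the values of B_1, ..., B_n. *)
Definition bhattacharyya_process (R : realType) (W : channel R) (n : nat)
    (b : n.-tuple bool) : R :=
  bhattacharyya (polarized W b).

(* The binary expansion b_1 ... b_n of i, most significant bit first. *)
Definition binary (n i : nat) : seq bool :=
  [seq odd (i %/ 2 ^ (n - k)) | k <- iota 1 n].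

Definition bit_channel (R : realType) (W : channel R) (n : nat)
    (i : 'I_(2 ^ n)) : channel R :=
  polarized W (binary n i).

Definition polar_kernel : 'M[bool]_2 := \matrix_(i < 2, j < 2) (j <= i)%N.

(* [A ^t n] is the n-th Kronecker power of A. *)
Definition polar_matrix (n : nat) : 'M[bool]_(2 ^ n) := polar_kernel ^t n.

(* A is one of the possible sets of information indices; there may be several
   ones, according to how ties are broken. *)
Definition is_info_set (R : realType) (W : channel R) (n : nat) (r : R)
    (A : {set 'I_(2 ^ n)}) : Prop :=
  (#|A|%:Z = Num.ceil ((2 ^ n)%:R * r)) /\
  (forall i j, i \in A -> j \notin A ->
     error_prob (bit_channel W i) <= error_prob (bit_channel W j)).

Section Decoding.
Variables (R : realType) (W : channel R) (n : nat).
Local Notation N := (2 ^ n)%N.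

(* The probability of the output y of N uses of W when x = u G_n is sent. *)
Definition likelihood (y : {ffun 'I_N -> output W}) (u : 'rV[bool]_N) : R :=
  \prod_(k < N) W (y k) ((u *m polar_matrix n) 0 k).

(* The transition probability W_N^(i)(y, u_0, ..., u_(i-1) | v), in the form
   used by the decoder; only the first i entries of u matter. *)
Definition bit_likelihood (i : 'I_N) (y : {ffun 'I_N -> output W})
    (u : 'rV[bool]_N) (v : bool) : R :=
  2 ^- N.-1 *
  \sum_(w : 'rV[bool]_N
        | [forall j : 'I_N, (j < i)%N ==> (w 0 j == u 0 j)] && (w 0 i == v))
     likelihood y w.

Variable A : {set 'I_N}.

(* [t i] is the coin used in case of a tie at step i. *)
Definition sc_decision (y : {ffun 'I_N -> output W}) (t : {ffun 'I_N -> bool})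
    (u : 'rV[bool]_N) (i : 'I_N) : bool :=
  if i \notin A then false
  else if bit_likelihood i y u true < bit_likelihood i y u false then false
  else if bit_likelihood i y u false < bit_likelihood i y u true then true
  else t i.

(* The entries of the accumulator are decided in increasing order of index, and
   are 0 until they are decided. *)
Definition sc_decode (y : {ffun 'I_N -> output W}) (t : {ffun 'I_N -> bool}) :
    'rV[bool]_N :=
  foldl (fun u i => \row_j (if j == i then sc_decision y t u i else u 0 j))
        0 (enum 'I_N).

Definition is_message (u : 'rV[bool]_N) : bool :=
  [forall i : 'I_N, (i \notin A) ==> ~~ u 0 i].

(* The message u is uniform among the 2^#|A| vectors vanishing outside A, the
   coins t are uniform and independent of u and of the channel. *)
Definition sc_block_error : \bar R :=
  (\sum_(u : 'rV[bool]_N | is_message u) \sum_(t : {ffun 'I_N -> bool})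
     (2 ^- #|A| * 2 ^- N)%R%:E *
     \esum_(y in [set: {ffun 'I_N -> output W}])
       (likelihood y u * (sc_decode y t != u)%:R)%R%:E)%E.

End Decoding.

(* Main.v *)
(* Besides the Bhattacharyya parameter Z, follow the total variation distance
   T = (1/2) sum_y |W(y|0) - W(y|1)|. The step 0 maps T to T^2 and Z to at
   most 2 Z, the step 1 maps Z to Z^2 and T to at most 2 T; moreover 1 - Z <=
   T, Z^2 + T^2 <= 1 and I <= 4 T.
   Let m = (1/rho) log(1/d) + O(1). By Markov's inequality and a geometric
   sum, outside an event of probability O(d), for all t >= 0 the value Z_(m+t)
   stays within 2^-(5 + 2 kappa t) of 0 or 1, where kappa = rho / (4 alpha).
   Such a trajectory is low (Z small) forever or high (T small) forever, and
   in both cases it is driven by squarings and doublings of a quantity that is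
   already at most 2^-(2 + kappa t). After n further steps with at least K
   squarings this quantity is at most 2^-(2^(K+1) / (n+1)^a), a being a
   constant with a kappa >= 1. It is thus below Pe 2^-(m+n) and d/16 as soon
   as K exceeds a multiple of log log(1/d), which fails with probability at
   most 2 (n+1)^K 2^-n; this is O(d) for n = log(1/d) + O((log log(4/d))^2).
   As the capacity is a martingale, the low trajectories have probability at
   least I(W) - d, so that enough indices have E <= Z <= Pe 2^-(m+n).
   The block error probability is at most the sum of the E(W_N^(i)) over the
   information indices: at the first wrong decision all the previous ones were
   right, and by symmetry of W the error probability of a decision that knows
   the true previous bits does not depend on the message. *)
Require Import Defs.
From mathcomp Require Import all_boot all_order all_algebra.
From mathcomp Require Import all_classical all_reals all_analysis.
From mathcomp Require Import mxtens ring lra.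

Set Implicit Arguments.
Unset Strict Implicit.
Unset Printing Implicit Defensive.

Import Order.TTheory GRing.Theory Num.Theory.

Local Open Scope ring_scope.

(** * Sums over countable alphabets *)

Section Esum.
Local Open Scope classical_set_scope.
Local Open Scope ring_scope.
Context {R : realType}.
Local Open Scope ereal_scope.

Lemma esum_prod (T1 T2 : choiceType) (a : T1 * T2 -> \bar R) :
  (forall x, 0 <= a x) ->
  \esum_(p in [set: T1 * T2]) a p =
  \esum_(x in [set: T1]) \esum_(y in [set: T2]) a (x, y).
Proof.
move=> a0.
rewrite (@esum_esum R T1 T2 setT (fun=> setT) (fun x y => a (x, y)))//.
have -> : [set: T1] `*`` (fun=> [set: T2]) = setT by apply/seteqP; split.
by apply: eq_esum => -[].
Qed.

(** The inequality [<=] holds on finite partial sums; the same inequality for [c^-1] and the scaled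
    family gives the converse. *)
Lemma ge0_esumZl (T : choiceType) (c : R) (a : T -> \bar R) :
  (0 <= c)%R -> (forall x, 0 <= a x) ->
  \esum_(x in [set: T]) (c%:E * a x) = c%:E * \esum_(x in [set: T]) a x.
Proof.
move=> c0 a0.
have aux (e : R) (b : T -> \bar R) : (0 <= e)%R -> (forall x, 0 <= b x) ->
    \esum_(x in [set: T]) (e%:E * b x) <= e%:E * \esum_(x in [set: T]) b x.
  move=> e0 b0; apply: ge_ereal_sup => _ [X [finX _] <-].
  rewrite -ge0_mule_fsumr// lee_wpmul2l ?lee_fin//.
  by apply: esum_ge; exists X.
move: c0; rewrite le_eqVlt => /predU1P[<-|c0].
  by rewrite mul0e; apply: esum1 => i _; rewrite mul0e.
apply/eqP; rewrite eq_le aux//=; last exact: ltW.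
rewrite -lee_pdivlMl//.
have := @aux c^-1%R (fun x => c%:E * a x).
rewrite invr_ge0 ltW// => /(_ isT) H.
apply: le_trans (H _).
  by apply: le_esum => x _; rewrite muleA -EFinM mulVf ?gt_eqF// mul1e.
by move=> x; apply: mule_ge0; rewrite ?lee_fin// ltW.
Qed.

Lemma esum_fintype (I : finType) (a : I -> \bar R) :
  (forall x, 0 <= a x) -> \esum_(x in [set: I]) a x = \sum_x a x.
Proof.
move=> a0; rewrite esum_fset//; last exact: finite_finset.
rewrite [RHS]fsbig_seq ?index_enum_uniq//.
suff -> : [set` index_enum I] = [set: I] by [].
by apply/seteqP; split => x //= _; exact: mem_index_enum.
Qed.

Lemma reindex_esumT (T1 T2 : choiceType) (e : T1 -> T2) (e' : T2 -> T1)
    (a : T2 -> \bar R) : cancel e e' -> cancel e' e ->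
  \esum_(y in [set: T2]) a y = \esum_(x in [set: T1]) a (e x).
Proof.
move=> eK e'K; apply: reindex_esum; split => //.
- by move=> x y _ _; exact: can_inj eK _ _.
- by move=> y _; exists (e' y).
Qed.

End Esum.

(** * Convergent sums of nonnegative reals *)

Section HasSum.
Local Open Scope classical_set_scope.
Local Open Scope ring_scope.
Context {R : realType}.
Implicit Types T : choiceType.

(** Nonnegativity and finiteness of the total are bundled, so that sums can be compared and combined
    as real numbers, away from infinite values. *)
Definition has_sum T (f : T -> R) (s : R) : Prop :=
  (forall x, 0 <= f x) /\ \esum_(x in [set: T]) (f x)%:E = s%:E.

Lemma has_sum_fine T (f : T -> R) s :
  has_sum f s -> fine (\esum_(x in [set: T]) (f x)%:E) = s.
Proof. by case=> _ ->. Qed.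

Lemma has_sum_uniq T (f : T -> R) s t : has_sum f s -> has_sum f t -> s = t.
Proof. by move=> [_ fs] [_]; rewrite fs => -[]. Qed.

Lemma has_sum_ext T (f g : T -> R) s : f =1 g -> has_sum f s -> has_sum g s.
Proof. by move=> /funext ->. Qed.

Lemma has_sum_ge0 T (f : T -> R) s : has_sum f s -> 0 <= s.
Proof.
by move=> [f0 fs]; rewrite -lee_fin -fs esum_ge0// => x _; rewrite lee_fin.
Qed.

Lemma has_sumD T (f g : T -> R) s t :
  has_sum f s -> has_sum g t -> has_sum (fun x => f x + g x) (s + t).
Proof.
move=> [f0 fs] [g0 gt]; split=> [x|]; first exact: addr_ge0.
under eq_esum do rewrite EFinD.
by rewrite esumD ?fs ?gt// => x _; rewrite lee_fin.
Qed.

Lemma has_sumZ T (c : R) (f : T -> R) s :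
  0 <= c -> has_sum f s -> has_sum (fun x => c * f x) (c * s).
Proof.
move=> c0 [f0 fs]; split=> [x|]; first exact: mulr_ge0.
under eq_esum do rewrite EFinM.
by rewrite ge0_esumZl ?fs// => x; rewrite lee_fin.
Qed.

Lemma has_sum_le T (f g : T -> R) s t :
  has_sum f s -> has_sum g t -> (forall x, f x <= g x) -> s <= t.
Proof.
move=> [f0 fs] [g0 gt] fg; rewrite -lee_fin -fs -gt.
by apply: le_esum => x _; rewrite lee_fin.
Qed.

(** The finiteness of all the functionals of a channel comes from here, by comparison with multiples
    of W(y|0) + W(y|1). *)
Lemma has_sum_dom T (f g : T -> R) t :
  (forall x, 0 <= f x <= g x) -> has_sum g t -> exists s, has_sum f s.
Proof.
move=> fg [g0 gt].
have fin : \esum_(x in [set: T]) (f x)%:E \is a fin_num.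
  rewrite ge0_fin_numE; last first.
    by apply: esum_ge0 => x _; rewrite lee_fin; case/andP: (fg x).
  apply: (@le_lt_trans _ _ t%:E); last exact: ltry.
  by rewrite -gt; apply: le_esum => x _; rewrite lee_fin; case/andP: (fg x).
exists (fine (\esum_(x in [set: T]) (f x)%:E)); split; last by rewrite fineK.
by move=> x; case/andP: (fg x).
Qed.

Lemma has_sum_prod (T1 T2 : choiceType) (f : T1 -> R) (g : T2 -> R) s t :
  has_sum f s -> has_sum g t ->
  has_sum (fun p : T1 * T2 => f p.1 * g p.2) (s * t).
Proof.
move=> fs gt; have [[f0 ef] [g0 eg]] := (fs, gt).
split=> [x|]; first exact: mulr_ge0.
rewrite esum_prod; last by move=> p; rewrite lee_fin mulr_ge0.
rewrite (@eq_esum _ _ _ _ (fun x => t%:E * (f x)%:E)%E); last first.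
  move=> x _ /=; rewrite -EFinM mulrC.
  by have [_ <-] := has_sumZ (f0 x) gt.
rewrite ge0_esumZl ?(has_sum_ge0 gt)//.
by rewrite ef -EFinM mulrC.
Qed.

Lemma has_sum_bij (T1 T2 : choiceType) (e : T1 -> T2) e' (f : T2 -> R) s :
  cancel e e' -> cancel e' e -> has_sum f s -> has_sum (f \o e) s.
Proof.
move=> eK e'K [f0 fs]; split=> [x|]; first exact: f0.
by rewrite -fs (reindex_esumT _ eK e'K).
Qed.

Lemma has_sum_bool T (f : T * bool -> R) s t :
  has_sum (fun x => f (x, false)) s -> has_sum (fun x => f (x, true)) t ->
  has_sum f (s + t).
Proof.
move=> [f0 fs] [f1 ft].
have fge0 p : 0 <= f p by case: p => x [].
split=> //; rewrite esum_prod; last by move=> p; rewrite lee_fin.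
rewrite EFinD -fs -ft -esumD; try by move=> x _; rewrite lee_fin.
apply: eq_esum => x _; rewrite esum_fintype; last by move=> b; rewrite lee_fin.
by rewrite big_bool addeC.
Qed.

Lemma has_sum_slices T (f : T * bool -> R) s :
  has_sum f s -> has_sum (fun x => f (x, false) + f (x, true)) s.
Proof.
move=> [f0 fs]; split=> [x|]; first exact: addr_ge0.
rewrite -fs esum_prod; last by move=> p; rewrite lee_fin.
apply: eq_esum => x _; rewrite esum_fintype; last by move=> b; rewrite lee_fin.
by rewrite big_bool EFinD addeC.
Qed.

End HasSum.

(** * One step of polarization *)

Section RealFacts.
Context {R : realType}.

Lemma ln2_gt0 : 0 < ln 2 :> R.
Proof. by apply: ln_gt0; rewrite ltr1n. Qed.

Lemma ln2_ge0 : 0 <= ln 2 :> R.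
Proof. exact: ltW ln2_gt0. Qed.

Lemma ln_leB1 (x : R) : 0 < x -> ln x <= x - 1.
Proof.
move=> x0; have := @le_ln1Dx R (x - 1); have -> : 1 + (x - 1) = x by ring.
by apply; lra.
Qed.

Lemma ln2_ge : 2^-1 <= ln 2 :> R.
Proof.
have := @ln_leB1 2^-1; rewrite invr_gt0 ltr0n => /(_ isT).
by rewrite lnV ?posrE ?ltr0n//; lra.
Qed.

Lemma log2_ge0 (x : R) : 1 <= x -> 0 <= log2 x.
Proof. by move=> x1; rewrite divr_ge0 ?ln_ge0 ?ler1n. Qed.

Lemma log2M (x y : R) : 0 < x -> 0 < y -> log2 (x * y) = log2 x + log2 y.
Proof. by move=> x0 y0; rewrite /log2 lnM ?posrE// mulrDl. Qed.

Lemma log2V (x : R) : 0 < x -> log2 x^-1 = - log2 x.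
Proof. by move=> x0; rewrite /log2 lnV ?posrE// mulNr. Qed.

Lemma log2_2 : log2 2 = 1 :> R.
Proof. by rewrite /log2 divff// gt_eqF// ln2_gt0. Qed.

Lemma log2_leB1 (x : R) : 0 < x -> log2 x <= (x - 1) / ln 2.
Proof. by move=> x0; rewrite ler_pM2r ?invr_gt0 ?ln2_gt0// ln_leB1. Qed.

(* Contribution to a conditional entropy of an input symbol that has joint
   probability [a] with an output of total weight [s]. *)
Definition lterm (a s : R) : R := a * log2 (s / a).

Lemma lterm_ge0 (a s : R) : 0 <= a <= s -> 0 <= lterm a s.
Proof.
case/andP; rewrite le_eqVlt => /predU1P[<-|a0] as_.
  by rewrite /lterm mul0r.
by apply: mulr_ge0; [exact: ltW | rewrite log2_ge0// ler_pdivlMr// mul1r].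
Qed.

Lemma lterm_le (a s : R) : 0 <= a <= s -> lterm a s <= (s - a) / ln 2.
Proof.
case/andP; rewrite le_eqVlt => /predU1P[<-|a0] as_.
  by rewrite /lterm mul0r subr0 divr_ge0 ?ln2_ge0.
have sa0 : 0 < s / a by rewrite divr_gt0// (lt_le_trans a0).
apply: le_trans (ler_wpM2l (ltW a0) (log2_leB1 sa0)) _.
by rewrite mulrA mulrBr mulr1 mulrCA divff ?gt_eqF// mulr1.
Qed.

(** Write [log2 (s / a) = 1 - log2 (2 * a / s)], apply [log2 x <= (x - 1) / ln 2] and drop the
    factor [a / s <= 1]. With [s] the sum of two likelihoods, [s - a - a] is their difference. *)
Lemma lterm_ge (a s : R) : 0 <= a <= s ->
  a - `|s - a - a| / ln 2 <= lterm a s.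
Proof.
case/andP; rewrite le_eqVlt => /predU1P[<-|a0] as_.
  by rewrite /lterm mul0r sub0r oppr_le0 divr_ge0 ?ln2_ge0.
have s0 : 0 < s := lt_le_trans a0 as_.
have sa : s / a = 2 * (2 * a / s)^-1.
  by rewrite invf_div mulrA; field; rewrite !gt_eqF.
have t0 : 0 < 2 * a / s by rewrite divr_gt0// mulr_gt0.
rewrite /lterm sa log2M ?invr_gt0// log2V// log2_2 mulrBr mulr1 lerB//.
apply: le_trans (ler_wpM2l (ltW a0) (log2_leB1 t0)) _.
rewrite mulrA ler_pM2r ?invr_gt0 ?ln2_gt0//.
have -> : 2 * a / s - 1 = (a - (s - a)) / s by field; rewrite gt_eqF.
rewrite mulrCA mulrC -[leRHS]mul1r -normrN.
have -> : - (s - a - a) = a - (s - a) by ring.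
have as0 : 0 <= a / s by rewrite divr_ge0// ltW.
apply: (@le_trans _ _ (a / s * `|a - (s - a)|)).
  by rewrite ler_wpM2l// ler_norm.
by rewrite ler_wpM2r// ler_pdivrMr// mul1r.
Qed.

(** Chain rule: [log2 (s / x)] splits as [log2 (s / t) + log2 (t / x)] with [t = a + b]. *)
Lemma lterm_chain (a b s : R) : 0 <= a -> 0 <= b -> a + b <= s ->
  lterm (a + b) s + (lterm a (a + b) + lterm b (a + b)) = lterm a s + lterm b s.
Proof.
move=> a0 b0 abs.
have aux x t : 0 <= x <= t -> t <= s ->
    lterm x t + x * log2 (s / t) = lterm x s.
  case/andP; rewrite le_eqVlt => /predU1P[<-|x0] xt ts.
    by rewrite /lterm !mul0r addr0.
  have t0 := lt_le_trans x0 xt; have s0 := lt_le_trans t0 ts.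
  rewrite /lterm -mulrDr -log2M ?divr_gt0//; congr (_ * log2 _).
  by field; rewrite !gt_eqF.
rewrite -(aux a (a + b)) ?a0 ?lerDl// -(aux b (a + b)) ?b0 ?lerDr//.
by rewrite /lterm; ring.
Qed.

(** Additivity of entropy for independent symbols: the logarithm of the product of the ratios
    splits. *)
Lemma ltermM (k a s b t : R) : 0 < k -> 0 <= a <= s -> 0 <= b <= t ->
  lterm (k * a * b) (k * (s * t)) = k * (b * lterm a s + a * lterm b t).
Proof.
move=> k0; case/andP; rewrite le_eqVlt => /predU1P[<-|a0] as_.
  by move=> _; rewrite /lterm !(mul0r, mulr0, addr0).
case/andP; rewrite le_eqVlt => /predU1P[<-|b0] bt.
  by rewrite /lterm !(mul0r, mulr0, addr0).
have s0 := lt_le_trans a0 as_; have t0 := lt_le_trans b0 bt.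
have -> : lterm (k * a * b) (k * (s * t)) =
    k * a * b * log2 ((s / a) * (t / b)).
  by congr (_ * log2 _); field; rewrite !gt_eqF.
by rewrite log2M ?divr_gt0// /lterm; ring.
Qed.

End RealFacts.

(** * Functionals of a BMS channel and inequalities between them *)

Section Channel.
Local Open Scope classical_set_scope.
Local Open Scope ring_scope.
Context {R : realType}.
Implicit Types W : channel R.

Definition tv_dist W : R :=
  fine (\esum_(y in [set: output W]) (`|W y false - W y true| / 2)%:E).

Lemma BMS_ge0 W y x : is_BMS W -> 0 <= W y x.
Proof. by case. Qed.

Lemma BMS_has_sum W x : is_BMS W -> has_sum (fun y => W y x) 1.
Proof. by case=> W0 W1 _; split. Qed.

Lemma BMS_flip W : is_BMS W -> exists pi : output W -> output W,
  involutive pi /\ forall y x, W (pi y) x = W y (~~ x).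
Proof.
case=> _ _ [pi [piK Wpi]]; exists pi; split=> // y [] /=; last by rewrite Wpi.
by rewrite Wpi piK.
Qed.

Lemma BMS_sym W (f : R -> R -> R) s : is_BMS W ->
  has_sum (fun y => f (W y false) (W y true)) s ->
  has_sum (fun y => f (W y true) (W y false)) s.
Proof.
move=> /BMS_flip[pi [piK Wpi]] /(has_sum_bij piK piK).
by apply: has_sum_ext => y /=; rewrite !Wpi.
Qed.

Lemma has_sum_sum W : is_BMS W -> has_sum (fun y => W y false + W y true) 2.
Proof. by move=> bW; apply: has_sumD; apply: BMS_has_sum. Qed.

Lemma has_sum_half W : is_BMS W ->
  has_sum (fun y => (W y false + W y true) / 2) 1.
Proof.
move=> /has_sum_sum/(@has_sumZ _ _ 2^-1 _ _); rewrite mulVf// invr_ge0 ler0n.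
by move=> /(_ isT); apply: has_sum_ext => y; rewrite mulrC.
Qed.

Lemma has_sum_existsE (T : choiceType) (f : T -> R) :
  (exists s, has_sum f s) -> has_sum f (fine (\esum_(x in [set: T]) (f x)%:E)).
Proof. by case=> s fs; rewrite (has_sum_fine fs). Qed.

Lemma has_sum_bhattacharyya W : is_BMS W ->
  has_sum (fun y => Num.sqrt (W y false * W y true)) (bhattacharyya W).
Proof.
move=> bW; apply: has_sum_existsE; apply: has_sum_dom (has_sum_sum bW) => y.
have := BMS_ge0 y false bW; have := BMS_ge0 y true bW => q0 p0.
rewrite sqrtr_ge0 /= -[leRHS]ger0_norm ?addr_ge0// -sqrtr_sqr.
rewrite ler_sqrt ?sqr_ge0//.
by nra.
Qed.

Lemma has_sum_tv_dist W : is_BMS W ->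
  has_sum (fun y => `|W y false - W y true| / 2) (tv_dist W).
Proof.
move=> bW; apply: has_sum_existsE; apply: has_sum_dom (has_sum_half bW) => y.
have := BMS_ge0 y false bW; have := BMS_ge0 y true bW => q0 p0.
rewrite divr_ge0//= ler_pM2r// ler_norml; apply/andP; split; lra.
Qed.

Lemma has_sum_entropy W : is_BMS W ->
  has_sum (fun y => lterm (W y true) (W y false + W y true)) (entropy W).
Proof.
move=> bW; rewrite /entropy.
under eq_esum do rewrite addrC.
apply: has_sum_existsE.
have := has_sumZ _ (has_sum_sum bW) => /(_ (ln 2)^-1).
rewrite invr_ge0 ln2_ge0 => /(_ isT).
apply: has_sum_dom => y.
have := BMS_ge0 y false bW; have := BMS_ge0 y true bW => q0 p0.
rewrite lterm_ge0 ?q0 ?lerDr//=.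
apply: le_trans (lterm_le _) _; first by rewrite q0 lerDr.
by rewrite mulrC ler_pM2l ?invr_gt0 ?ln2_gt0//; lra.
Qed.

(** The entropy is defined from the input 1 only; the symmetry of the channel gives this form over
    both inputs, to which the chain rule applies. *)
Lemma has_sum_2entropy W : is_BMS W ->
  has_sum (fun y => lterm (W y false) (W y false + W y true) +
                    lterm (W y true) (W y false + W y true)) (2 * entropy W).
Proof.
move=> bW; rewrite mulrDl mul1r; apply: has_sumD; last exact: has_sum_entropy.
have := BMS_sym (f := fun p q => lterm q (p + q)) bW (has_sum_entropy bW).
by apply: has_sum_ext => y; rewrite addrC.
Qed.

Lemma entropy_ge0 W : is_BMS W -> 0 <= entropy W.
Proof. by move=> /has_sum_entropy/has_sum_ge0. Qed.

Lemma capacity_le1 W : is_BMS W -> capacity W <= 1.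
Proof. by move=> bW; rewrite /capacity gerBl entropy_ge0. Qed.

Lemma bhattacharyya_ge0 W : is_BMS W -> 0 <= bhattacharyya W.
Proof. by move=> /has_sum_bhattacharyya/has_sum_ge0. Qed.

Lemma tv_dist_ge0 W : is_BMS W -> 0 <= tv_dist W.
Proof. by move=> /has_sum_tv_dist/has_sum_ge0. Qed.

(** Sum [lterm_ge] over the outputs; the constant 4 comes from [1 / ln 2 <= 2] and from the factor
    1/2 in [tv_dist]. *)
Lemma capacity_le_tv_dist W : is_BMS W ->
  capacity W <= 4 * tv_dist W.
Proof.
move=> bW; rewrite /capacity lerBlDr.
have := has_sumD (has_sumZ _ (has_sum_tv_dist bW)) (has_sum_entropy bW).
move=> /(_ 4 (ler0n _ _)) H; apply: has_sum_le (BMS_has_sum true bW) H _ => y.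
have := BMS_ge0 y false bW; have := BMS_ge0 y true bW => q0 p0.
rewrite addrC -lerBlDr.
have := @lterm_ge _ (W y true) (W y false + W y true).
rewrite q0 lerDr p0 addrK => /(_ isT); apply: le_trans.
rewrite lerD2l lerN2 mulrCA ler_wpM2l//.
rewrite -[leLHS]div1r ler_pdivrMr ?ln2_gt0//.
by have := @ln2_ge R; lra.
Qed.

(** Pointwise, with a and b the square roots of the two likelihoods, |a^2 - b^2| = |a - b| (a + b)
    >= (a - b)^2. *)
Lemma ge1_bhattacharyyaD W : is_BMS W ->
  1 <= bhattacharyya W + tv_dist W.
Proof.
move=> bW.
have H := has_sumD (has_sum_bhattacharyya bW) (has_sum_tv_dist bW).
apply: has_sum_le (has_sum_half bW) H _ => y.
have := BMS_ge0 y false bW; have := BMS_ge0 y true bW.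
move: (W y false) (W y true) => p q q0 p0.
rewrite sqrtrM//.
have [sp sq] : 0 <= Num.sqrt p /\ 0 <= Num.sqrt q by rewrite !sqrtr_ge0.
rewrite -[in leLHS](sqr_sqrtr p0) -[in leLHS](sqr_sqrtr q0).
rewrite -[in `|_|](sqr_sqrtr p0) -[in `|_|](sqr_sqrtr q0).
move: (Num.sqrt p) (Num.sqrt q) sp sq => a b a0 b0.
rewrite subr_sqr normrM (@ger0_norm _ (a + b)) ?addr_ge0//.
case: (leP a b) => ab.
  by rewrite ler0_norm ?subr_le0//; nra.
by rewrite gtr0_norm ?subr_gt0//; nra.
Qed.

(** At each output with likelihoods p and q, the vector of coordinates sqrt(pq) and |p - q|/2 has
    Euclidean norm (p + q)/2. By Cauchy-Schwarz its inner product with (Z, T) is at most [N] (p +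
    q)/2, where [N] is the norm of (Z, T); summing gives [N ^+ 2 <= N]. *)
Lemma sqr_bhattacharyyaD W : is_BMS W ->
  bhattacharyya W ^+ 2 + tv_dist W ^+ 2 <= 1.
Proof.
move=> bW; set Z := bhattacharyya W; set T := tv_dist W.
have Z0 : 0 <= Z by exact: bhattacharyya_ge0.
have T0 : 0 <= T by exact: tv_dist_ge0.
have H := has_sumD (has_sumZ Z0 (has_sum_bhattacharyya bW))
                   (has_sumZ T0 (has_sum_tv_dist bW)).
set N := Num.sqrt (Z ^+ 2 + T ^+ 2).
have N0 : 0 <= N by exact: sqrtr_ge0.
have N2 : N ^+ 2 = Z ^+ 2 + T ^+ 2 by rewrite sqr_sqrtr// addr_ge0 ?sqr_ge0.
suff : Z * Z + T * T <= N * 1 by rewrite -!expr2 -N2; nra.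
apply: has_sum_le H (has_sumZ N0 (has_sum_half bW)) _ => y.
have := BMS_ge0 y false bW; have := BMS_ge0 y true bW.
move: (W y false) (W y true) => p q q0 p0.
have [t0 z0] : 0 <= `|p - q| /\ 0 <= Num.sqrt (p * q) by rewrite sqrtr_ge0.
have z2 : Num.sqrt (p * q) ^+ 2 = p * q by rewrite sqr_sqrtr// mulr_ge0.
have t2 : `|p - q| ^+ 2 = (p - q) ^+ 2 by rewrite real_normK// num_real.
rewrite -(@ler_pXn2r _ 2)// ?nnegrE; last 2 first.
- by rewrite addr_ge0// mulr_ge0// divr_ge0.
- by rewrite mulr_ge0// divr_ge0// addr_ge0.
move: (Num.sqrt _) `|p - q| z2 t2 z0 t0 => z t z2 t2 z0 t0.
rewrite [leRHS]exprMn N2.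
have -> : ((p + q) / 2) ^+ 2 = z ^+ 2 + (t / 2) ^+ 2.
  by rewrite z2 !exprMn t2; field.
move: (t / 2) => u.
have := sqr_ge0 (Z * u - T * z); nra.
Qed.

Lemma bhattacharyya_le1 W : is_BMS W -> bhattacharyya W <= 1.
Proof.
move=> bW; have := sqr_bhattacharyyaD bW; have := bhattacharyya_ge0 bW.
by have := tv_dist_ge0 bW; nra.
Qed.

Lemma error_term_le W y : is_BMS W ->
  0 <= W y true * ((W y true < W y false)%R%:R
                 + 2^-1 * (W y false == W y true)%:R)
    <= Num.sqrt (W y false * W y true).
Proof.
move=> bW; have := BMS_ge0 y false bW; have := BMS_ge0 y true bW.
move: (W y false) (W y true) => p q q0 p0.
rewrite mulr_ge0 ?addr_ge0 ?mulr_ge0//=.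
case: (ltgtP q p) => [qp|qp|->];
  rewrite /= ?mulr0 ?addr0 ?mulr0 ?mulr1 ?sqrtr_ge0//.
  rewrite -[leLHS]ger0_norm// -sqrtr_sqr ler_sqrt ?mulr_ge0//.
  by rewrite expr2 ler_wpM2r// ltW.
by rewrite add0r -expr2 sqrtr_sqr ger0_norm// ler_piMr// invf_le1 ?ler1n.
Qed.

Lemma has_sum_error_prob W : is_BMS W ->
  has_sum (fun y => W y true * ((W y true < W y false)%R%:R
                 + 2^-1 * (W y false == W y true)%:R)) (error_prob W).
Proof.
move=> bW; apply: has_sum_existsE.
by apply: has_sum_dom (has_sum_bhattacharyya bW) => y; exact: error_term_le.
Qed.

Lemma error_prob_le_bhattacharyya W : is_BMS W ->
  error_prob W <= bhattacharyya W.
Proof.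
move=> bW.
apply: has_sum_le (has_sum_error_prob bW) (has_sum_bhattacharyya bW) _ => y.
by case/andP: (error_term_le y bW).
Qed.

End Channel.

(** * Effect of one transform on each functional *)

Section Transforms.
Local Open Scope classical_set_scope.
Local Open Scope ring_scope.
Context {R : realType}.
Implicit Types W : channel R.

Lemma minus_transformE W y x : minus_transform W y x =
  2^-1 * W y.1 x * W y.2 false + 2^-1 * W y.1 (~~ x) * W y.2 true.
Proof. by rewrite /= big_bool [LHS]addrC; case: x. Qed.

Lemma plus_transformE W y x :
  plus_transform W y x = 2^-1 * W y.1.1 (y.2 (+) x) * W y.1.2 x.
Proof. by []. Qed.

(** The weight of an output [(y, b)] of the step 1 is a likelihood of the step 0; this lets the
    entropies of the two steps enter one chain rule. *)
Lemma plus_transform_sum W y b :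
  plus_transform W (y, b) false + plus_transform W (y, b) true =
  minus_transform W y b.
Proof. by rewrite minus_transformE !plus_transformE/= addbF addbT. Qed.

Lemma minus_transform_sum W y :
  minus_transform W y false + minus_transform W y true =
  2^-1 * ((W y.1 false + W y.1 true) * (W y.2 false + W y.2 true)).
Proof. by rewrite !minus_transformE/=; ring. Qed.

(** The difference of likelihoods turns exclusive or into a product, whence the exact squaring of
    [tv_dist]. *)
Lemma minus_transform_diff W y :
  minus_transform W y false - minus_transform W y true =
  2^-1 * ((W y.1 false - W y.1 true) * (W y.2 false - W y.2 true)).
Proof. by rewrite !minus_transformE/=; ring. Qed.

Lemma minus_transform_BMS W : is_BMS W -> is_BMS (minus_transform W).
Proof.
move=> bW; have [pi [piK Wpi]] := BMS_flip bW.
have W0 y x : 0 <= W y x by exact: BMS_ge0.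
split.
- by move=> y x; rewrite minus_transformE addr_ge0// !mulr_ge0// invr_ge0.
- move=> x.
  have h (a b : bool) : has_sum (fun p => 2^-1 * W p.1 a * W p.2 b) 2^-1.
    have := @has_sumZ R _ 2^-1 _ _ _
      (has_sum_prod (BMS_has_sum a bW) (BMS_has_sum b bW)).
    rewrite !mulr1 invr_ge0 ler0n => /(_ isT).
    by apply: has_sum_ext => p; rewrite mulrA.
  have [_] := has_sumD (h x false) (h (~~ x) true).
  have -> : 2^-1 + 2^-1 = 1 :> R by field.
  by move=> <-; apply: eq_esum => y _; rewrite minus_transformE.
exists (fun y => (pi y.1, y.2)); split=> [[y1 y2]|y]; first by rewrite /= piK.
by rewrite !minus_transformE/= !Wpi.
Qed.

Lemma plus_transform_BMS W : is_BMS W -> is_BMS (plus_transform W).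
Proof.
move=> bW; have [pi [piK Wpi]] := BMS_flip bW.
have W0 y x : 0 <= W y x by exact: BMS_ge0.
split.
- by move=> y x; rewrite plus_transformE !mulr_ge0// invr_ge0.
- move=> x.
  have h (a b : bool) : has_sum (fun p => 2^-1 * W p.1 a * W p.2 b) 2^-1.
    have := @has_sumZ R _ 2^-1 _ _ _
      (has_sum_prod (BMS_has_sum a bW) (BMS_has_sum b bW)).
    rewrite !mulr1 invr_ge0 ler0n => /(_ isT).
    by apply: has_sum_ext => p; rewrite mulrA.
  have [_] := @has_sum_bool R _ (fun y => plus_transform W y x) _ _
    (h (false (+) x) x) (h (true (+) x) x).
  by have -> : 2^-1 + 2^-1 = 1 :> R by field.
exists (fun y => (pi y.1.1, pi y.1.2, y.2)); split=> [[[y1 y2] b]|[[y1 y2] b]].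
  by rewrite /= !piK.
by rewrite !plus_transformE/= !Wpi addbT addbF.
Qed.

Lemma transform_BMS W b : is_BMS W -> is_BMS (transform W b).
Proof. by case: b; [exact: plus_transform_BMS|exact: minus_transform_BMS]. Qed.

Lemma polarized_BMS W s : is_BMS W -> is_BMS (polarized W s).
Proof. by elim: s W => //= b s IH W /(transform_BMS b)/IH. Qed.

Lemma bhattacharyya_plus W : is_BMS W ->
  bhattacharyya (plus_transform W) = bhattacharyya W ^+ 2.
Proof.
move=> bW; have bW' := plus_transform_BMS bW.
have W0 y x : 0 <= W y x by exact: BMS_ge0.
have Z := has_sum_bhattacharyya bW.
have := @has_sumZ R _ 2^-1 _ _ _ (has_sum_prod Z Z).
rewrite invr_ge0 ler0n => /(_ isT) H.
have -> : bhattacharyya W ^+ 2 = 2^-1 * (bhattacharyya W * bhattacharyya W) +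
  2^-1 * (bhattacharyya W * bhattacharyya W) by field.
apply: has_sum_uniq (has_sum_bhattacharyya bW') _.
have e (y : output W * output W) b :
  2^-1 * (Num.sqrt (W y.1 false * W y.1 true) *
          Num.sqrt (W y.2 false * W y.2 true)) =
  Num.sqrt (plus_transform W (y, b) false * plus_transform W (y, b) true).
  have h0 : 0 <= 2^-1 :> R by rewrite invr_ge0.
  rewrite !plus_transformE/= addbF addbT.
  have -> : 2^-1 * W y.1 b * W y.2 false * (2^-1 * W y.1 (~~ b) * W y.2 true) =
    (2^-1) ^+ 2 * (W y.1 false * W y.1 true) * (W y.2 false * W y.2 true).
    by case: b => /=; ring.
  rewrite [RHS]sqrtrM; first last.
    by apply: mulr_ge0; [exact: sqr_ge0 | exact: mulr_ge0].
  rewrite [Num.sqrt (2^-1 ^+ 2 * _)]sqrtrM ?sqr_ge0//.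
  by rewrite sqrtr_sqr ger0_norm// mulrA.
by apply: has_sum_bool; apply: has_sum_ext H => y; exact: e.
Qed.

(** Each term is at most the sum of two products, each of a Bhattacharyya term of one copy and a
    half-sum of likelihoods of the other; half-sums have total 1. *)
Lemma bhattacharyya_minus W : is_BMS W ->
  bhattacharyya (minus_transform W) <= 2 * bhattacharyya W.
Proof.
move=> bW; have bW' := minus_transform_BMS bW.
have W0 y x : 0 <= W y x by exact: BMS_ge0.
have Z := has_sum_bhattacharyya bW; have S := has_sum_half bW.
have H := has_sumD (has_sum_prod Z S) (has_sum_prod S Z).
have -> : 2 * bhattacharyya W =
  bhattacharyya W * 1 + 1 * bhattacharyya W by ring.
apply: has_sum_le (has_sum_bhattacharyya bW') H _ => -[y1 y2].
rewrite !minus_transformE/=.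
have := W0 y1 false; have := W0 y1 true.
have := W0 y2 false; have := W0 y2 true.
move: (W y1 _) (W y1 _) (W y2 _) (W y2 _) => p1 q1 p2 q2 q20 p20 q10 p10.
have sqrtE (x : R) : 0 <= x -> exists2 a, 0 <= a & x = a ^+ 2.
  by move=> x0; exists (Num.sqrt x); rewrite ?sqr_sqrtr ?sqrtr_ge0.
have [a a0 ->] := sqrtE _ p10; have [b b0 ->] := sqrtE _ q10.
have [c c0 ->] := sqrtE _ p20; have [d d0 ->] := sqrtE _ q20.
rewrite -[a ^+ 2 * b ^+ 2]exprMn -[c ^+ 2 * d ^+ 2]exprMn.
rewrite [Num.sqrt ((a * b) ^+ 2)]sqrtr_sqr.
rewrite [Num.sqrt ((c * d) ^+ 2)]sqrtr_sqr !ger0_norm ?mulr_ge0//.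
set rhs := (X in _ <= X).
have r0 : 0 <= rhs by rewrite /rhs !(addr_ge0, mulr_ge0)// ?sqr_ge0.
rewrite -[leRHS]ger0_norm// -sqrtr_sqr ler_sqrt ?sqr_ge0//.
have -> : rhs =
    2^-1 * (a * b * (c ^+ 2 + d ^+ 2) + (a ^+ 2 + b ^+ 2) * (c * d)).
  by rewrite /rhs; field.
have ab0 : 0 <= a * b by rewrite mulr_ge0.
have cd0 : 0 <= c * d by rewrite mulr_ge0.
rewrite -subr_ge0.
set t := (X in 0 <= X).
(* After squaring, the difference of the two sides has only nonnegative terms in the square roots
   [a], [b], [c], [d]. *)
have -> : t =
   2^-1 * ((a * b) * (c * d) * ((c ^+ 2 + d ^+ 2) * (a ^+ 2 + b ^+ 2)))
   + (a * b) ^+ 2 * (c * d) ^+ 2.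
  by rewrite /t; field.
by rewrite !(addr_ge0, mulr_ge0)// ?sqr_ge0.
Qed.

Lemma tv_dist_minus W : is_BMS W ->
  tv_dist (minus_transform W) = tv_dist W ^+ 2.
Proof.
move=> bW; have bW' := minus_transform_BMS bW.
have T := has_sum_tv_dist bW; rewrite expr2.
apply: has_sum_uniq (has_sum_tv_dist bW') _.
apply: has_sum_ext (has_sum_prod T T) => y; rewrite minus_transform_diff.
by rewrite !normrM ger0_norm ?invr_ge0//; field.
Qed.

(** Write x y - x' y' as half of (x - x')(y + y') + (x + x')(y - y') and use the triangle
    inequality. The bound is the same for both values of the extra output bit. *)
Lemma tv_dist_plus W : is_BMS W ->
  tv_dist (plus_transform W) <= 2 * tv_dist W.
Proof.
move=> bW; have bW' := plus_transform_BMS bW.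
have W0 y x : 0 <= W y x by exact: BMS_ge0.
have T := has_sum_tv_dist bW; have S := has_sum_half bW.
have := @has_sumZ R _ 2^-1 _ _ _
  (has_sumD (has_sum_prod T S) (has_sum_prod S T)).
rewrite invr_ge0 ler0n => /(_ isT) H.
have -> : 2 * tv_dist W =
  2^-1 * (tv_dist W * 1 + 1 * tv_dist W) +
  2^-1 * (tv_dist W * 1 + 1 * tv_dist W) by field.
pose g (y : output W * output W * bool) :=
  2^-1 * ((`|W y.1.1 false - W y.1.1 true| / 2) *
            ((W y.1.2 false + W y.1.2 true) / 2) +
          ((W y.1.1 false + W y.1.1 true) / 2) *
            (`|W y.1.2 false - W y.1.2 true| / 2)).
have Hg := @has_sum_bool R _ g _ _ H H.
apply: has_sum_le (has_sum_tv_dist bW') Hg _ => -[[y1 y2] b].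
rewrite !plus_transformE/= addbF addbT /g/=.
have := W0 y1 false; have := W0 y1 true.
have := W0 y2 false; have := W0 y2 true.
have -> : 2^-1 * W y1 b * W y2 false - 2^-1 * W y1 (~~ b) * W y2 true =
  4^-1 * ((W y1 b - W y1 (~~ b)) * (W y2 false + W y2 true) +
    (W y1 false + W y1 true) * (W y2 false - W y2 true)).
  by case: b => /=; field.
have -> : `|W y1 false - W y1 true| = `|W y1 b - W y1 (~~ b)|.
  by case: b => //=; rewrite distrC.
move=> q20 p20 q10 p10.
rewrite normrM (@ger0_norm _ 4^-1) ?invr_ge0//.
have := ler_normD ((W y1 b - W y1 (~~ b)) * (W y2 false + W y2 true))
  ((W y1 false + W y1 true) * (W y2 false - W y2 true)).
rewrite !normrM (@ger0_norm _ (W y2 false + W y2 true)) ?addr_ge0//.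
rewrite (@ger0_norm _ (W y1 false + W y1 true)) ?addr_ge0//.
lra.
Qed.

(** Two independent uses of [W] have total entropy [2 * entropy W]. By the chain rule this is the
    entropy of the first input bit given the outputs (step 0) plus that of the second given also the
    first (step 1). *)
Lemma entropy_transform W : is_BMS W ->
  entropy (minus_transform W) + entropy (plus_transform W) = 2 * entropy W.
Proof.
move=> bW.
have bW0 := minus_transform_BMS bW; have bW1 := plus_transform_BMS bW.
have W0 y x : 0 <= W y x by exact: BMS_ge0.
have m0 y x : 0 <= minus_transform W y x by exact: BMS_ge0.
have p0 y x : 0 <= plus_transform W y x by exact: BMS_ge0.
have H := has_sum_2entropy bW; have S := has_sum_sum bW.
have H0 := has_sum_2entropy bW0.
pose h (y : output W * output W) b :=
  lterm (plus_transform W (y, b) false) (minus_transform W y b) +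
  lterm (plus_transform W (y, b) true) (minus_transform W y b).
have H1 : has_sum (fun y => h y false + h y true)
    (2 * entropy (plus_transform W)).
  apply: has_sum_ext (has_sum_slices (has_sum_2entropy bW1)) => y.
  by rewrite /h !plus_transform_sum.
have := @has_sumZ R _ 2^-1 _ _ _
  (has_sumD (has_sum_prod H S) (has_sum_prod S H)).
rewrite invr_ge0 ler0n => /(_ isT) HH.
suff : 2 * entropy (minus_transform W) + 2 * entropy (plus_transform W) =
  2^-1 * (2 * entropy W * 2 + 2 * (2 * entropy W)) by lra.
apply: has_sum_uniq (has_sumD H0 H1) _.
apply: has_sum_ext HH => -[y1 y2].
rewrite /h minus_transform_sum.
have half : 0 < 2^-1 :> R by rewrite invr_gt0.
have b1 b : 0 <= W y1 b <= W y1 false + W y1 true.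
  by rewrite W0; case: b; rewrite ?lerDl ?lerDr ?W0.
have b2 b : 0 <= W y2 b <= W y2 false + W y2 true.
  by rewrite W0; case: b; rewrite ?lerDl ?lerDr ?W0.
have le b : minus_transform W (y1, y2) b <=
    2^-1 * ((W y1 false + W y1 true) * (W y2 false + W y2 true)).
  rewrite -(@minus_transform_sum W (y1, y2)).
  by case: b; rewrite ?lerDl ?lerDr ?W0.
(* The chain rule at fixed outputs, restricted to the value [b] of the first bit. *)
have key b : lterm (minus_transform W (y1, y2) b)
      (2^-1 * ((W y1 false + W y1 true) * (W y2 false + W y2 true))) +
    (lterm (plus_transform W (y1, y2, b) false) (minus_transform W (y1, y2) b) +
     lterm (plus_transform W (y1, y2, b) true) (minus_transform W (y1, y2) b)) =
    2^-1 * (W y2 false * lterm (W y1 b) (W y1 false + W y1 true) +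
            W y1 b * lterm (W y2 false) (W y2 false + W y2 true)) +
    2^-1 * (W y2 true * lterm (W y1 (~~ b)) (W y1 false + W y1 true) +
            W y1 (~~ b) * lterm (W y2 true) (W y2 false + W y2 true)).
  rewrite -[in LHS]plus_transform_sum lterm_chain ?plus_transform_sum//.
  by rewrite !plus_transformE addbF addbT !ltermM.
by rewrite [RHS]addrACA (key false) (key true) /=; field.
Qed.

Lemma capacity_transform W : is_BMS W ->
  capacity (minus_transform W) + capacity (plus_transform W) = 2 * capacity W.
Proof. by move=> /entropy_transform; rewrite /capacity; lra. Qed.

End Transforms.

(** * Trajectories of the polarization process *)

Section Average.
Context {R : realType}.

(** The recursion on the first coin follows that of [polarized], whose first step uses the head of
    the sequence. *)
Fixpoint avg (n : nat) (f : seq bool -> R) : R :=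
  if n is m.+1 then (avg m (fun s => f (false :: s)) +
                     avg m (fun s => f (true :: s))) / 2
  else f [::].

Lemma eq_avg n f g : (forall s, size s = n -> f s = g s) -> avg n f = avg n g.
Proof.
elim: n f g => [|n IH] f g fg /=; first exact: fg.
by congr ((_ + _) / 2); apply: IH => s sn; apply: fg; rewrite /= sn.
Qed.

Lemma le_avg n f g : (forall s, size s = n -> f s <= g s) -> avg n f <= avg n g.
Proof.
elim: n f g => [|n IH] f g fg /=; first exact: fg.
rewrite ler_pM2r ?invr_gt0//.
by apply: lerD; apply: IH => s sn; apply: fg; rewrite /= sn.
Qed.

Lemma avg_cst n c : avg n (fun=> c) = c.
Proof. by elim: n => //= n ->; field. Qed.

Lemma avgD n f g : avg n (fun s => f s + g s) = avg n f + avg n g.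
Proof. by elim: n f g => //= n IH f g; rewrite !IH; field. Qed.

Lemma avgZ n c f : avg n (fun s => c * f s) = c * avg n f.
Proof. by elim: n f => //= n IH f; rewrite !IH; field. Qed.

Lemma avg_sum n m (f : nat -> seq bool -> R) :
  avg n (fun s => \sum_(t < m) f t s) = \sum_(t < m) avg n (f t).
Proof.
elim: m => [|m IH].
  by rewrite big_ord0 -[RHS](avg_cst n); apply: eq_avg => s _; rewrite big_ord0.
rewrite big_ord_recr/= -IH -avgD; apply: eq_avg => s _.
by rewrite big_ord_recr.
Qed.

Lemma avg_take n k f : (k <= n)%N -> avg n (fun s => f (take k s)) = avg k f.
Proof.
elim: n k f => [|n IH] [|k] f kn //=.
  by rewrite !avg_cst; field.
by rewrite (IH k (fun s => f (false :: s)))// (IH k (fun s => f (true :: s))).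
Qed.

Lemma avg_drop m n f : avg (m + n) (fun s => f (drop m s)) = avg n f.
Proof.
elim: m => [|m IH] /=; first by apply: eq_avg => s _; rewrite drop0.
by rewrite IH; field.
Qed.

Lemma coin_expectationE n (f : seq bool -> R) :
  coin_expectation (fun b : n.-tuple bool => f b) = avg n f.
Proof.
rewrite /coin_expectation -big_distrr/=.
elim: n f => [|n IH] f.
  rewrite expr0 invr1 mul1r (bigD1 [tuple])//= big1 ?addr0//.
  by move=> i /eqP[]; exact: tuple0.
rewrite [avg _ _]/= -!IH.
have -> : \sum_(b : n.+1.-tuple bool) f b =
    \sum_(p : bool * n.-tuple bool) f (p.1 :: p.2).
  apply: (reindex (fun p : bool * n.-tuple bool => [tuple of p.1 :: p.2])).
  exists (fun t => (thead t, [tuple of behead t])) => [[b t] _|t _] /=.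
    by congr (_, _); apply: val_inj.
  by rewrite [RHS]tuple_eta.
rewrite -(pair_bigA _ (fun b (t : n.-tuple bool) => f (b :: t)))/= big_bool/=.
by rewrite exprS invfM; ring.
Qed.

(** Conditioning on the first coin gives Pascal's recursion, and (n+1)^(K+1) + (n+1)^K = (n+2)
    (n+1)^K is at most (n+2)^(K+1). *)
Lemma avg_count (c : bool) n K :
  avg n (fun s => (count_mem c s <= K)%N%:R) <= (n.+1 ^ K)%:R / (2 ^ n)%:R.
Proof.
elim: n K => [|n IH] K; first by rewrite /= exp1n divr1.
have -> : avg n.+1 (fun s => (count_mem c s <= K)%N%:R) =
    (avg n (fun s => (count_mem c s <= K)%N%:R) +
     avg n (fun s => (count_mem c s < K)%N%:R)) / 2.
  by case: c {IH} => /=; [|rewrite addrC]; congr ((_ + _) / 2);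
    apply: eq_avg => s _.
have n2 : 0 < (2 ^ n)%:R :> R by rewrite ltr0n expn_gt0.
have -> : (n.+2 ^ K)%:R / (2 ^ n.+1)%:R = ((n.+2 ^ K)%:R / (2 ^ n)%:R) / 2 :> R.
  by rewrite expnSr natrM; field; rewrite gt_eqF.
rewrite ler_pM2r ?invr_gt0//.
case: K => [|K].
  have -> : avg n (fun s => (count_mem c s < 0)%N%:R) = 0.
    by rewrite -[RHS](avg_cst n); apply: eq_avg.
  by rewrite addr0; apply: le_trans (IH 0%N) _; rewrite !expn0.
apply: le_trans (lerD (IH K.+1) (IH K)) _.
rewrite -mulrDl ler_pM2r ?invr_gt0// -natrD ler_nat.
rewrite !expnS -[X in (_ + X)%N]mul1n -mulnDl addn1 leq_mul2l /=.
by case: K {IH} => [|K]; [rewrite !expn0|rewrite leq_exp2r].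
Qed.

End Average.

(** * Decay under squarings and doublings *)

Section Decay.
Context {R : realType}.
Variables (kappa : R) (a : nat).
Hypotheses (kappa_gt0 : 0 < kappa) (a_gt0 : (0 < a)%N) (ak : 1 <= a%:R * kappa).

Definition level (t : nat) : R := 2 + kappa * t%:R.

Lemma level_ge2 t : 2 <= level t.
Proof. by rewrite lerDl mulr_ge0// ltW. Qed.

Lemma pow2_ge0 (x : R) : 0 <= 2 `^ x. Proof. exact: powR_ge0. Qed.

Lemma pow2D (x y : R) : 2 `^ (x + y) = 2 `^ x * 2 `^ y.
Proof. by rewrite powRD// pnatr_eq0 implybT. Qed.

Lemma ler_pow2 (x y : R) : x <= y -> 2 `^ x <= 2 `^ y.
Proof. by move=> xy; rewrite ler_powR// ler1n. Qed.

(** With u = t + 1, Bernoulli's inequality bounds (u / (u + 1))^a by u / (u + a) = 1 - a / (u + a),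
    and [1 <= a%:R * kappa] gives u + a <= a ([level t]). *)
Lemma ratio_le t : (t.+1%:R / t.+2%:R) ^+ a <= 1 - (level t)^-1.
Proof.
set u : R := t.+1%:R; have u0 : 0 < u by rewrite ltr0n.
have -> : t.+2%:R = u + 1 :> R by rewrite -natr1.
have bern (k : nat) : u ^+ k * (u + k%:R) <= (u + 1) ^+ k * u.
  elim: k => [|k IH]; first by rewrite !expr0 addr0.
  have uk : 0 <= u ^+ k by rewrite exprn_ge0// ltW.
  have k0 : 0 <= k%:R :> R by rewrite ler0n.
  apply: (@le_trans _ _ ((u + 1) * (u ^+ k * (u + k%:R)))); last first.
    by rewrite [(u + 1) ^+ k.+1]exprS -mulrA ler_wpM2l// addr_ge0// ltW.
  rewrite exprS -natr1 -subr_ge0.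
  have -> : (u + 1) * (u ^+ k * (u + k%:R)) - u * u ^+ k * (u + (k%:R + 1)) =
    u ^+ k * k%:R by ring.
  exact: mulr_ge0.
have l0 : 0 < level t by apply: lt_le_trans (level_ge2 t); rewrite ltr0n.
have ua : 0 < u + a%:R by rewrite addr_gt0// ltr0n.
have u1 : 0 < u + 1 by rewrite addr_gt0.
apply: (@le_trans _ _ (u / (u + a%:R))).
  rewrite expr_div_n ler_pdivrMr ?exprn_gt0// mulrAC ler_pdivlMr//.
  by rewrite [leRHS]mulrC.
have -> : u / (u + a%:R) = 1 - a%:R / (u + a%:R) by field; rewrite gt_eqF.
rewrite lerD2l lerN2 -[leLHS]div1r ler_pdivrMr// mulrAC ler_pdivlMr// mul1r.
rewrite /level mulrDr mulrA /u -[t.+1%:R]natr1.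
have a1 : 1 <= a%:R :> R by rewrite ler1n.
have : t%:R <= a%:R * kappa * t%:R by rewrite ler_peMl.
lra.
Qed.

(* Write [x = 2^-y]. A doubling of [x] subtracts 1 from [y >= level t], hence
   costs a factor at most [((t + 1) / (t + 2))^a]; these factors telescope to
   [(n + 1)^-a] over the whole trajectory, while each squaring doubles [y]. *)
Lemma squaring_decay (x : nat -> R) (sq : nat -> bool) n :
  (forall t, 0 <= x t) ->
  (forall t, (t < n)%N -> x t.+1 <= if sq t then x t ^+ 2 else 2 * x t) ->
  (forall t, (t <= n)%N -> x t <= 2 `^ (- level t)) ->
  x n <= 2 `^ (- (2 * 2 ^+ (\sum_(t < n) sq t) / n.+1%:R ^+ a)).
Proof.
move=> x0; elim: n => [|n IH] step xl.
  rewrite big_ord0 expr0 mulr1 expr1n divr1.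
  by have := xl 0%N isT; rewrite /level mulr0 addr0.
have {}IH : x n <= 2 `^ (- (2 * 2 ^+ (\sum_(t < n) sq t) / n.+1%:R ^+ a)).
  by apply: IH => t tn; [apply: step; exact: ltnW | apply: xl; exact: ltnW].
rewrite big_ord_recr /=; set K := (\sum_(t < n) sq t)%N in IH *.
set g := 2 * 2 ^+ K / n.+1%:R ^+ a in IH.
have g0 : 0 <= g by rewrite divr_ge0 ?exprn_ge0// mulr_ge0// exprn_ge0.
set r : R := (n.+1%:R / n.+2%:R) ^+ a.
have r0 : 0 <= r by rewrite exprn_ge0// divr_ge0.
have r1 : r <= 1 by rewrite exprn_ile1 ?divr_ge0// ler_pdivrMr// mul1r ler_nat.
have rl : r <= 1 - (level n)^-1 := ratio_le n.
have l2 := level_ge2 n.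
have grE : 2 * 2 ^+ K / n.+2%:R ^+ a = g * r.
  by rewrite /g /r expr_div_n mulrA divfK// expf_neq0// pnatr_eq0.
have := step n (ltnSn n); case: (sq n) => xS; apply: le_trans xS _.
  apply: (@le_trans _ _ ((2 `^ (- g)) ^+ 2)).
    by rewrite lerXn2r ?nnegrE ?pow2_ge0.
  rewrite expr2 -pow2D ler_pow2// addn1 exprSr mulrA mulrAC.
  rewrite grE; nra.
rewrite addn0 grE.
have xn := xl n (leqnSn n).
(* Both known exponents are kept: a doubling leaves the exponent [y - 1], which is at least
   [y * (1 - (level n)^-1)] since [y >= level n], hence at least [g * r] since [y >= g]. *)
pose y := Num.max g (level n).
have xy : x n <= 2 `^ (- y) by rewrite /y; case: (leP g (level n)).
apply: (@le_trans _ _ (2 * 2 `^ (- y))); first by rewrite ler_wpM2l.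
rewrite -[X in X * _](@powRr1 _ 2)// -pow2D ler_pow2//.
have yg : g <= y by rewrite le_max lexx.
have yl : level n <= y by rewrite le_max lexx orbT.
have ly : 1 <= y * (level n)^-1.
  by rewrite ler_pdivlMr ?mul1r//; lra.
have : g * r <= y * (1 - (level n)^-1).
  by apply: ler_pM.
lra.
Qed.

End Decay.

(** * Trajectories that stay extreme *)

Section Trajectory.
Context {R : realType}.
Variables (kappa : R) (a : nat).
Hypotheses (kappa_gt0 : 0 < kappa) (a_gt0 : (0 < a)%N) (ak : 1 <= a%:R * kappa).
Implicit Types W : channel R.
Local Notation level := (level kappa).

Lemma polarized_rcons W s b :
  polarized W (rcons s b) = transform (polarized W s) b.
Proof. by rewrite /polarized foldl_rcons. Qed.

(** The capacity is a martingale; the induction peels off the first coin. *)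
Lemma avg_capacity W n : is_BMS W ->
  avg n (fun s => capacity (polarized W s)) = capacity W.
Proof.
elim: n W => [|n IH] W bW //=.
rewrite (IH (minus_transform W)) ?(IH (plus_transform W)).
- by rewrite capacity_transform//; field.
- exact: plus_transform_BMS.
- exact: minus_transform_BMS.
Qed.

Lemma bhattacharyya_transform W b : is_BMS W -> bhattacharyya (transform W b) <=
  if b then bhattacharyya W ^+ 2 else 2 * bhattacharyya W.
Proof.
by case: b => bW; [rewrite /= bhattacharyya_plus|exact: bhattacharyya_minus].
Qed.

Lemma tv_dist_transform W b : is_BMS W -> tv_dist (transform W b) <=
  if ~~ b then tv_dist W ^+ 2 else 2 * tv_dist W.
Proof.
by case: b => bW; [exact: tv_dist_plus|rewrite /= tv_dist_minus].
Qed.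

(* The margin is such that [Z <= margin t] and [Z >= 1 - margin t] respectively
   force [Z] and the total variation distance below [2^-level t]. *)
Definition margin t : R := 2 `^ (- (2 * level t + 1)).

Lemma margin_gt0 t : 0 < margin t. Proof. by rewrite powR_gt0. Qed.

Lemma margin_le t : margin t <= 32^-1.
Proof.
have -> : 32^-1 = 2 `^ (- 5%:R) :> R.
  by rewrite powR_invn//; congr (_^-1); ring.
apply: ler_pow2; have := level_ge2 kappa_gt0 t; lra.
Qed.

Lemma margin_level t : 2 * margin t = 2 `^ (- level t) ^+ 2.
Proof.
rewrite /margin expr2 -pow2D -[X in X * _](@powRr1 _ 2)// -pow2D.
by congr (_ `^ _); ring.
Qed.

Lemma pow2_level_le t : 2 `^ (- level t) <= 4^-1.
Proof.
have -> : 4^-1 = 2 `^ (- 2%:R) :> R.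
  by rewrite powR_invn//; congr (_^-1); ring.
apply: ler_pow2; have := level_ge2 kappa_gt0 t; lra.
Qed.

Definition extreme t W : bool :=
  (bhattacharyya W <= margin t) || (1 - margin t <= bhattacharyya W).

Lemma tv_dist_high W t : is_BMS W -> 1 - margin t <= bhattacharyya W ->
  tv_dist W <= 2 `^ (- level t).
Proof.
move=> bW zh; have := sqr_bhattacharyyaD bW.
have v0 := tv_dist_ge0 bW; have z0 := bhattacharyya_ge0 bW.
have d0 := margin_gt0 t; have d1 := margin_le t.
move=> zv; rewrite -(@ler_pXn2r _ 2) ?nnegrE ?pow2_ge0// -margin_level.
nra.
Qed.

(* A single step cannot cross the gap between [margin] and [1 - margin]. *)
Lemma low_or_high W (s : seq bool) m n : is_BMS W -> size s = (m + n)%N ->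
  (forall t, (t <= n)%N ->
     extreme t (polarized W (take (m + t) s))) ->
  (forall t, (t <= n)%N ->
     bhattacharyya (polarized W (take (m + t) s)) <= 2 `^ (- level t)) \/
  (forall t, (t <= n)%N ->
     tv_dist (polarized W (take (m + t) s)) <= 2 `^ (- level t)).
Proof.
move=> bW sz pol.
have bWt t : is_BMS (polarized W (take (m + t) s)) by exact: polarized_BMS.
have next t : (t < n)%N -> polarized W (take (m + t.+1) s) =
    transform (polarized W (take (m + t) s)) (nth false s (m + t)).
  by move=> tn; rewrite addnS (take_nth false) ?sz ?ltn_add2l// polarized_rcons.
have low_le t : margin t <= 2 `^ (- level t).
  have := pow2_level_le t; have := pow2_ge0 (- level t).
  have := margin_level t; have := margin_gt0 t; nra.
case/orP: (pol 0%N isT) => z0; [left|right].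
  have low t : (t <= n)%N ->
      bhattacharyya (polarized W (take (m + t) s)) <= margin t.
    elim: t => // t IH tn; have zt := IH (ltnW tn).
    (* A value at most 1/32 is at most doubled, so it cannot reach 1 - 1/32. *)
    case/orP: (pol t.+1 tn) => //; rewrite next// => zh.
    have := bhattacharyya_transform (nth false s (m + t)) (bWt t).
    have := bhattacharyya_ge0 (bWt t); have := bhattacharyya_le1 (bWt t).
    have := margin_le t; have := margin_le t.+1.
    by case: (nth _ _ _) in zh *; nra.
  by move=> t tn; exact: le_trans (low t tn) (low_le t).
have high t : (t <= n)%N ->
    1 - margin t <= bhattacharyya (polarized W (take (m + t) s)).
  elim: t => // t IH tn; have zt := IH (ltnW tn).
  case/orP: (pol t.+1 tn) => // zl.
  (* Here T <= 1/4 becomes at most 1/2, so that Z >= 1 - T >= 1/2 at the next time, well above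
     [margin]. *)
  have vt := tv_dist_high (bWt t) zt; have q := pow2_level_le t.
  have := tv_dist_transform (nth false s (m + t)) (bWt t); rewrite -next//.
  have := ge1_bhattacharyyaD (bWt t.+1).
  have := tv_dist_ge0 (bWt t).
  have := margin_le t; have := margin_le t.+1.
  by case: (nth _ _ _) => /=; nra.
by move=> t tn; exact: tv_dist_high (high t tn).
Qed.

Lemma count_nth (c : bool) (s : seq bool) m n : size s = (m + n)%N ->
  count_mem c (drop m s) = (\sum_(t < n) (nth false s (m + t) == c))%N.
Proof.
move=> sz; rewrite -sum1_count big_mkcond (big_nth false) big_mkord.
rewrite size_drop sz addKn; apply: eq_bigr => t _; rewrite nth_drop.
by rewrite -mulnbl muln1.
Qed.

Definition decay n K : R := 2 `^ (- (2 * 2 ^+ K / n.+1%:R ^+ a)).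

(** The coins 1 square Z and the coins 0 square T; both counts are bounded below because the
    trajectory may be low or high. *)
Lemma trajectory_end W (s : seq bool) m n K : is_BMS W -> size s = (m + n)%N ->
  (forall t, (t <= n)%N ->
     extreme t (polarized W (take (m + t) s))) ->
  (K <= count_mem true (drop m s))%N -> (K <= count_mem false (drop m s))%N ->
  bhattacharyya (polarized W s) <= decay n K \/
  tv_dist (polarized W s) <= decay n K.
Proof.
move=> bW sz pol K1 K0; set e := decay n K.
have bWt t : is_BMS (polarized W (take (m + t) s)) by exact: polarized_BMS.
have next t : (t < n)%N -> polarized W (take (m + t.+1) s) =
    transform (polarized W (take (m + t) s)) (nth false s (m + t)).
  by move=> tn; rewrite addnS (take_nth false) ?sz ?ltn_add2l// polarized_rcons.
have takes : take (m + n) s = s by rewrite -sz take_size.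
have le_e k : (K <= k)%N -> 2 `^ (- (2 * 2 ^+ k / n.+1%:R ^+ a)) <= e :> R.
  move=> Kk; apply: ler_pow2; rewrite lerN2 ler_pM2r ?invr_gt0 ?exprn_gt0//.
  by rewrite ler_pM2l// ler_weXn2l// ler1n.
rewrite (count_nth true sz) in K1; rewrite (count_nth false sz) in K0.
have [xl|xl] := low_or_high bW sz pol; [left|right].
  apply: le_trans (le_e _ K1); rewrite -{1}takes.
  apply: (squaring_decay kappa_gt0 a_gt0 ak
    (x := fun t => bhattacharyya (polarized W (take (m + t) s)))
    (sq := fun t => nth false s (m + t) == true)) xl => t.
    exact: bhattacharyya_ge0.
  by move=> tn; rewrite next// eqb_id; exact: bhattacharyya_transform.
apply: le_trans (le_e _ K0); rewrite -{1}takes.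
apply: (squaring_decay kappa_gt0 a_gt0 ak
  (x := fun t => tv_dist (polarized W (take (m + t) s)))
  (sq := fun t => nth false s (m + t) == false)) xl => t.
  exact: tv_dist_ge0.
by move=> tn; rewrite next// eqbF_neg; exact: tv_dist_transform.
Qed.

(** For each coin sequence either the end is good, or one of the exceptional indicators is 1 and
    dominates the capacity, or T <= [decay n K] and the capacity is at most 4 T. The martingale
    property then averages this bound. *)
Lemma capacity_le_good W m n K : is_BMS W ->
  capacity W <=
    avg (m + n) (fun s => (bhattacharyya (polarized W s) <= decay n K)%R%:R) +
    \sum_(t < n.+1) avg (m + t) (fun s => (~~ extreme t (polarized W s))%:R) +
    2 * ((n.+1 ^ K)%:R / (2 ^ n)%:R) + 4 * decay n K.
Proof.
move=> bW; set e := decay n K; rewrite -(avg_capacity (m + n) bW).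
pose bad t s : R := (~~ extreme t (polarized W s))%:R.
apply: (@le_trans _ _ (avg (m + n) (fun s =>
    (bhattacharyya (polarized W s) <= e)%R%:R +
    \sum_(t < n.+1) bad t (take (m + t) s) +
    ((count_mem true (drop m s) <= K)%N%:R +
     (count_mem false (drop m s) <= K)%N%:R) + 4 * e))).
  apply: le_avg => s sz; have bWs := polarized_BMS s bW.
  have e0 : 0 <= e by exact: pow2_ge0.
  have bad0 : 0 <= \sum_(t < n.+1) bad t (take (m + t) s).
    by rewrite sumr_ge0// => t _; rewrite ler0n.
  have I1 := capacity_le1 bWs.
  have [g0 c0 c1] : [/\ 0 <= (bhattacharyya (polarized W s) <= e)%R%:R :> R,
    0 <= (count_mem true (drop m s) <= K)%N%:R :> R &
    0 <= (count_mem false (drop m s) <= K)%N%:R :> R] by rewrite !ler0n.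
  case: leqP c0 => [_ _|K1 _]; first by move: I1 c1; rewrite mulr1n; lra.
  case: leqP c1 => [_ _|K0 _]; first by move: I1; rewrite mulr1n mulr0n; lra.
  case: (boolP [forall t : 'I_n.+1, bad t (take (m + t) s) == 0]); last first.
    rewrite negb_forall => /existsP[t bt].
    have -> : \sum_(t < n.+1) bad t (take (m + t) s) =
        1 + \sum_(i < n.+1 | i != t) bad i (take (m + i) s).
      rewrite (bigD1 t)//=; congr (_ + _); move: bt; rewrite /bad.
      by case: extreme => //=; rewrite eqxx.
    rewrite !mulr0n.
    have : 0 <= \sum_(i < n.+1 | i != t) bad i (take (m + i) s).
      by rewrite sumr_ge0// => i _; rewrite ler0n.
    lra.
  move=> /forallP pol.
  have pol' t : (t <= n)%N -> extreme t (polarized W (take (m + t) s)).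
    move=> tn; have := pol (Ordinal (tn : (t < n.+1)%N)); rewrite /bad/=.
    by case: extreme => //=; rewrite oner_eq0.
  have [->|vt] := trajectory_end bW sz pol' (ltnW K1) (ltnW K0).
    by rewrite mulr1n !mulr0n; lra.
  have := capacity_le_tv_dist bWs.
  by move: g0 vt; rewrite -/e !mulr0n; lra.
rewrite avgD avg_cst lerD2r avgD avgD avgD.
rewrite (@avg_sum _ _ _ (fun t s => bad t (take (m + t) s))).
apply: lerD.
  rewrite lerD2l; apply: ler_sum => t _.
  have tn : (m + t <= m + n)%N by rewrite leq_add2l -ltnS.
  by rewrite (avg_take (bad t) tn).
rewrite (avg_drop _ _ (fun s => (count_mem true s <= K)%N%:R)).
rewrite (avg_drop _ _ (fun s => (count_mem false s <= K)%N%:R)).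
by rewrite mulrDl mul1r lerD// avg_count.
Qed.

End Trajectory.

(** * Choice of the block-length *)

Section BlockLength.
Context {R : realType}.

Lemma exists_nat_above (x : R) : 0 <= x -> exists n : nat, x <= n%:R <= x + 1.
Proof.
move=> x0; exists (Num.truncn x).+1.
have /andP[x1 x2] := truncn_itv x0.
by rewrite (ltW x2)/= -natr1 lerD2r.
Qed.

Lemma pow2_log2 (x : R) : 0 < x -> 2 `^ (log2 x) = x.
Proof.
move=> x0; rewrite /powR pnatr_eq0/= /log2 divfK ?gt_eqF ?ln2_gt0//.
by rewrite lnK.
Qed.

Lemma ler_log2 (x y : R) : 0 < x -> x <= y -> log2 x <= log2 y.
Proof.
move=> x0 xy; have y0 := lt_le_trans x0 xy.
by rewrite ler_pM2r ?invr_gt0 ?ln2_gt0// ler_ln.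
Qed.

Lemma log2X (x : R) n : 0 < x -> log2 (x ^+ n) = n%:R * log2 x.
Proof. by move=> x0; rewrite /log2 lnXn// -[X in X / _]mulr_natl mulrA. Qed.

Lemma log2_le (x : R) : 1 <= x -> log2 x <= 2 * x.
Proof.
move=> x1; have x0 : 0 < x by rewrite (lt_le_trans ltr01).
apply: le_trans (log2_leB1 x0) _.
by rewrite ler_pdivrMr ?ln2_gt0//; have := @ln2_ge R; nra.
Qed.

(** The left side is quadratic in [s], at most 32 (A + 1) (s + 1)^2; as soon as s >= 32 (A + 1) this
    is at most (s + 1)^4 <= 16^s. *)
Lemma exists_exp16 (A : R) : 0 <= A -> exists s : nat,
  (4 * s%:R + 5) * (A * (4 * s%:R + 5) + (A + 4 * s%:R + 2) + 1) + 1 <= 16 ^+ s.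
Proof.
move=> A0.
have [s /andP[As _]] := @exists_nat_above (32 * (A + 1))
  (mulr_ge0 (ler0n _ _) (addr_ge0 A0 ler01)).
exists s.
have s2 : s%:R + 1 <= 2 ^+ s :> R.
  by rewrite natr1 -natrX ler_nat ltn_expl.
have s0 : 0 <= s%:R :> R by [].
have -> : 16 ^+ s = (2 ^+ s) ^+ 4 :> R.
  by rewrite -exprM mulnC exprM; congr (_ ^+ _); ring.
apply: (@le_trans _ _ ((s%:R + 1) ^+ 4)); last first.
  by rewrite lerXn2r// nnegrE ?exprn_ge0// addr_ge0.
apply: (@le_trans _ _ (32 * (A + 1) * (s%:R + 1) ^+ 2)).
  nra.
rewrite -[4%N]/((2 + 2)%N) exprD ler_wpM2r ?sqr_ge0//.
nra.
Qed.

(** Markov's inequality: outside the extreme set, Z (1 - Z) is at least [margin kappa t / 2], whose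
    power [alpha] is the inverse of the last factor. *)
Lemma avg_not_extreme (kappa alpha beta rho : R) (W : channel R) (n t : nat) :
  0 < kappa -> 0 < alpha -> is_BMS W ->
  avg n (fun s => (bhattacharyya (polarized W s) *
    (1 - bhattacharyya (polarized W s))) `^ alpha) <=
    beta * 2 `^ (- (rho * n%:R)) ->
  avg n (fun s => (~~ extreme kappa t (polarized W s))%:R) <=
  beta * 2 `^ (- (rho * n%:R)) * 2 `^ (alpha * (2 * level kappa t + 2)).
Proof.
move=> k0 a0 bW H.
set c := 2 `^ (alpha * _); have c0 : 0 <= c by exact: powR_ge0.
apply: le_trans (ler_wpM2r c0 H); rewrite mulrC -avgZ.
apply: le_avg => s _; have bWs := polarized_BMS s bW.
have z0 := bhattacharyya_ge0 bWs; have z1 := bhattacharyya_le1 bWs.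
case: (boolP (extreme _ _ _)) => /= [_|]; first by rewrite mulr_ge0// powR_ge0.
rewrite negb_or -!ltNge => /andP[].
move: (bhattacharyya _) z0 z1 => z z0 z1 zl zh.
have d0 := margin_gt0 kappa t; have d1 := margin_le k0 t.
have -> : c = ((margin kappa t / 2) `^ alpha)^-1.
  rewrite -powRN.
  have -> : margin kappa t / 2 = 2 `^ (- (2 * level kappa t + 2)).
    rewrite /margin -[X in _ / X](@powRr1 _ 2)// -powRN -pow2D.
    by congr (_ `^ _); ring.
  by rewrite -powRrM; congr (_ `^ _); ring.
rewrite mulrC ler_pdivlMr ?powR_gt0 ?divr_gt0// mul1r.
apply: ge0_ler_powR; rewrite ?nnegrE.
- exact: ltW.
- by rewrite divr_ge0// ltW.
- by rewrite mulr_ge0//; lra.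
- nra.
Qed.

Lemma geometric_sum_le (q : R) n : 0 <= q -> q < 1 ->
  \sum_(t < n) q ^+ t <= (1 - q)^-1.
Proof.
move=> q0 q1; rewrite -[leRHS]div1r ler_pdivlMr ?subr_gt0//.
by have := subrX1 q n; have := exprn_ge0 n q0; set S := \sum_(t < n) _; lra.
Qed.

(** For this [kappa], the Markov factor at time [t] is 2^(6 alpha + rho t / 2), while the hypothesis
    at time m + t gains 2^(-rho t): a geometric series of ratio 2^(-rho / 2) remains. *)
Lemma sum_not_extreme (alpha beta rho : R) (W : channel R) (m n : nat) :
  0 < alpha -> 0 < beta -> 0 < rho -> is_BMS W ->
  (forall n, avg n (fun s => (bhattacharyya (polarized W s) *
    (1 - bhattacharyya (polarized W s))) `^ alpha) <=
    beta * 2 `^ (- (rho * n%:R))) ->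
  \sum_(t < n) avg (m + t) (fun s =>
    (~~ extreme (rho / (4 * alpha)) t (polarized W s))%:R) <=
  beta * 2 `^ (6 * alpha) / (1 - 2 `^ (- (rho / 2))) * 2 `^ (- (rho * m%:R)).
Proof.
move=> a0 b0 r0 bW H; set kappa := rho / (4 * alpha).
have k0 : 0 < kappa by rewrite divr_gt0// mulr_gt0.
set q : R := 2 `^ (- (rho / 2)).
have q0 : 0 <= q by exact: pow2_ge0.
have q1 : q < 1.
  rewrite /q /powR pnatr_eq0/= expR_lt1 pmulr_llt0 ?ln2_gt0//.
  by rewrite oppr_lt0 divr_gt0.
have := ler_wpM2l
  (ltW (mulr_gt0 (mulr_gt0 b0 (powR_gt0 (6 * alpha) (ltr0Sn R 1)))
  (powR_gt0 (- (rho * m%:R)) (ltr0Sn R 1)))) (geometric_sum_le n q0 q1).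
rewrite [leRHS](_ : _ =
  beta * 2 `^ (6 * alpha) / (1 - q) * 2 `^ (- (rho * m%:R))); last by ring.
apply: le_trans; rewrite mulr_sumr; apply: ler_sum => t _.
apply: le_trans (avg_not_extreme t k0 a0 bW (H (m + t)%N)) _.
rewrite -powR_mulrn// -powRrM -!mulrA -!pow2D.
apply: ler_wpM2l; first exact: ltW.
apply: ler_pow2.
rewrite /level natrD /kappa le_eqVlt; apply/orP; left; apply/eqP.
by field; rewrite gt_eqF.
Qed.

(** Here [l] stands for [log2 (4 / d)]. The four conditions control the block-length, the
    trajectories that are not extreme, those with few squarings, and the final decay. With n = l +
    O((log l)^2), the numbers [log2 n.+1] and [K] are both O(log l), so their product fits in the
    excess of [n] over [l]. *)
Lemma choose_parameters (rho C1 P : R) (a : nat) :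
  0 < rho -> 0 <= C1 -> 2 <= P -> exists2 c : R, 0 < c & forall l : R, 2 <= l ->
  exists m n K : nat,
  [/\ (m + n)%:R <= (1 + rho^-1) * (l - 2) + c * log2 l ^+ 2,
     l + C1 <= rho * m%:R,
     log2 n.+1%:R * K%:R + 1 + l <= n%:R &
     m%:R + n%:R + P <= 2 * 2 ^+ K / n.+1%:R ^+ a].
Proof.
move=> rho0 C10 P2.
(* Chosen for the bound [M <= C3 * D * l ^+ 2] below: 8 accounts for [n] and 1 for the rounding of
   [m]. *)
set C3 : R := (1 + C1) / rho + 9 + P.
have C31 : 1 <= C3.
  have : 0 <= (1 + C1) / rho by rewrite divr_ge0 ?addr_ge0// ltW.
  by rewrite /C3; lra.
set A : R := Num.max a%:R (log2 C3).
have A0 : 0 <= A by rewrite le_max ler0n.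
have [s sA] := exists_exp16 A0.
(* [D] bounds a quadratic polynomial in its own logarithm [4 * s]. *)
set D : R := 16 ^+ s in sA.
have D1 : 1 <= D by rewrite exprn_ege1// ler1n.
have D0 : 0 < D by rewrite (lt_le_trans ltr01).
have log2D : log2 D = 4 * s%:R.
  rewrite /D log2X// (_ : 16 = 2 ^+ 4); last by ring.
  by rewrite log2X// log2_2 mulr1 mulrC.
(* Replacing [l] by [l - 2] in the main term costs (2 + C1) / rho and 2; the roundings of [m] and
   [n] cost 2 more. These constants are absorbed by [log2 l ^+ 2 >= 1]. *)
exists ((2 + C1) / rho + 4 + D).
  have : 0 <= (2 + C1) / rho by rewrite divr_ge0 ?addr_ge0// ltW.
  by lra.
move=> l l2; set lam := log2 l.
have l0 : 0 < l by rewrite (lt_le_trans _ l2).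
have lam1 : 1 <= lam by rewrite -(@log2_2 R) ler_log2.
have laml : lam <= 2 * l by apply: log2_le; apply: le_trans l2; rewrite ler1n.
have lam0 : 0 <= lam by apply: le_trans lam1.
have [m /andP[lm ml]] := @exists_nat_above ((l + C1) / rho)
  (divr_ge0 (addr_ge0 (ltW l0) C10) (ltW rho0)).
have [n /andP[ln nl]] := @exists_nat_above (l + D * lam ^+ 2)
  (addr_ge0 (ltW l0) (mulr_ge0 (ltW D0) (sqr_ge0 _))).
set N1 : R := n.+1%:R; set M : R := m%:R + n%:R + P.
have n8 : N1 <= 8 * D * l ^+ 2.
  have lamX : D * lam ^+ 2 <= D * (4 * l ^+ 2) by rewrite ler_pM2l//; nra.
  have lX : l ^+ 2 <= D * l ^+ 2 by rewrite ler_peMl// sqr_ge0.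
  have : 2 * l <= l ^+ 2 by rewrite expr2 ler_pM2r.
  by rewrite /N1 -natr1; lra.
have X1 : 1 <= D * l ^+ 2 by nra.
have lX : l <= D * l ^+ 2 by nra.
have nN : n%:R <= N1 by rewrite /N1 ler_nat.
have N10 : 0 < N1 by rewrite ltr0n.
have MC : M <= C3 * D * l ^+ 2.
  have : (l + C1) / rho <= (1 + C1) / rho * (D * l ^+ 2).
    rewrite mulrAC ler_pM2r ?invr_gt0// mulrDl mul1r lerD// ler_peMr//.
  have : P <= P * (D * l ^+ 2) by rewrite ler_peMr//; lra.
  rewrite /M /C3; lra.
have M0 : 0 < M.
  by rewrite /M ltr_wpDl ?addr_ge0//; lra.
set u := log2 N1; set w := log2 M.
have u0 : 0 <= u by rewrite log2_ge0// ler1n.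
have w0 : 0 <= w.
  by rewrite log2_ge0// /M; have := ler0n R m; have := ler0n R n; lra.
have lamsq : 1 <= lam ^+ 2 by rewrite exprn_ege1.
have slam : s%:R <= s%:R * lam by rewrite ler_peMr.
have logX c : 0 < c -> log2 (c * D * l ^+ 2) = log2 c + 4 * s%:R + 2 * lam.
  move=> c0; have [cD0 ll0] := (mulr_gt0 c0 D0, exprn_gt0 2 l0).
  by rewrite (log2M cD0 ll0) (log2M c0 D0) (log2X 2 l0) log2D.
have ul : u <= (4 * s%:R + 5) * lam.
  have := ler_log2 N10 n8; rewrite logX// (_ : 8 = 2 ^+ 3); last by ring.
  rewrite (@log2X 2 3)// log2_2 -/u; lra.
have wl : w <= (A + 4 * s%:R + 2) * lam.
  have C30 : 0 < C3 by apply: lt_le_trans C31.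
  have := ler_log2 M0 MC; rewrite logX//.
  have : log2 C3 <= A by rewrite le_max lexx orbT.
  have : A <= A * lam by rewrite ler_peMr.
  rewrite -/w; lra.
have aA : a%:R <= A by rewrite le_max lexx.
(* This makes 2^K at least [N1 ^+ a * M]. *)
have [K /andP[wK Kw]] := @exists_nat_above (a%:R * u + w)
  (addr_ge0 (mulr_ge0 (ler0n _ _) u0) w0).
(* Both [u] and [K] are at most constants times [lam]; by [sA] the product of these constants, plus
   1, is at most [D]. *)
have uK : u * K%:R + 1 <= D * lam ^+ 2.
  set U := 4 * s%:R + 5 in ul sA; set V := A + 4 * s%:R + 2 in wl sA.
  have U0 : 0 <= U by rewrite addr_ge0// mulr_ge0.
  have V0 : 0 <= V by rewrite !addr_ge0// mulr_ge0.
  have KB : K%:R <= (A * U + V + 1) * lam.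
    have : a%:R * u <= A * (U * lam) by rewrite ler_pM.
    lra.
  have : u * K%:R <= (U * lam) * ((A * U + V + 1) * lam) by rewrite ler_pM.
  have : (U * (A * U + V + 1) + 1) * lam ^+ 2 <= D * lam ^+ 2.
    by rewrite ler_wpM2r ?sqr_ge0.
  lra.
have N1X k : N1 ^+ k = 2 `^ (u * k%:R).
  by rewrite powRrM pow2_log2// powR_mulrn// ltW.
have two_X k : 2 ^+ k = 2 `^ k%:R :> R by rewrite powR_mulrn.
have decay_exp : M <= 2 * 2 ^+ K / N1 ^+ a.
  rewrite ler_pdivlMr ?exprn_gt0// N1X -[X in X * _](pow2_log2 M0) -pow2D two_X.
  rewrite -[leLHS]mul1r ler_pM ?pow2_ge0 ?ler1n// ler_pow2//.
  by rewrite -/w addrC [u * _]mulrC.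
exists m, n, K; split=> //; first last.
- by rewrite -/N1 -/u; lra.
- by move: lm; rewrite ler_pdivrMr// mulrC.
rewrite natrD -/lam; clear -ml nl lamsq C10 rho0; move: ml nl.
set c0 := (2 + C1) / rho => ml nl.
have c0_ge0 : 0 <= c0 + 4 by rewrite addr_ge0// divr_ge0 ?addr_ge0// ltW.
have -> : (1 + rho^-1) * (l - 2) = l - 2 + (l + C1) / rho - c0.
  by rewrite /c0; ring.
by have := ler_peMr c0_ge0 lamsq; lra.
Qed.

(** The three loss terms of [capacity_le_good] are each made at most d/4, and [decay] at most Pe /
    N, with parameters chosen for [l = log2 (4 / d)]. *)
Lemma polarization_speed (alpha beta rho Pe : R) :
  0 < alpha -> 0 < beta -> 0 < rho -> 0 < Pe ->
  exists2 c : R, 0 < c & forall W : channel R, is_BMS W ->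
  (forall n, avg n (fun s => (bhattacharyya (polarized W s) *
    (1 - bhattacharyya (polarized W s))) `^ alpha) <=
    beta * 2 `^ (- (rho * n%:R))) ->
  forall d : R, 0 < d < 1 -> exists n : nat,
    n%:R <= (1 + rho^-1) * log2 d^-1 + c * log2 (log2 (4 / d)) ^+ 2 /\
    capacity W - d <=
      avg n (fun s => (bhattacharyya (polarized W s) <= Pe / (2 ^ n)%:R)%R%:R).
Proof.
move=> alpha0 beta0 rho0 Pe0.
(* With this slope, the bound on the probability of not being extreme at time
   [m + t] is [2^(- rho t / 2)] times its value at time [m]. *)
set kappa := rho / (4 * alpha).
have k0 : 0 < kappa by rewrite divr_gt0// mulr_gt0.
have [a /andP[ak _]] := @exists_nat_above (1 + kappa^-1)
  (addr_ge0 ler01 (ltW (etrans (invr_gt0 kappa) k0))).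
have a_gt0 : (0 < a)%N.
  by rewrite -(ltr_nat R); apply: lt_le_trans ak; rewrite addr_gt0// invr_gt0.
have {}ak : 1 <= a%:R * kappa.
  by rewrite -ler_pdivrMr// div1r; apply: le_trans ak; rewrite lerDr.
set C0 : R := beta * 2 `^ (6 * alpha) / (1 - 2 `^ (- (rho / 2))).
have C00 : 0 < C0.
  rewrite divr_gt0 ?mulr_gt0 ?powR_gt0// subr_gt0.
  by rewrite /powR pnatr_eq0/= expR_lt1 pmulr_llt0 ?ln2_gt0// oppr_lt0 divr_gt0.
set C1 : R := Num.max 0 (log2 C0).
have C10 : 0 <= C1 by rewrite le_max lexx.
have C0C1 : C0 <= 2 `^ C1.
  by rewrite -[leLHS]pow2_log2// ler_pow2// le_max lexx orbT.
(* The 2 pays for the factor 4 in front of [decay]; the other argument yields the factor [Pe]. *)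
set P : R := Num.max 2 (- log2 Pe).
have P2 : 2 <= P by rewrite le_max lexx.
have PPe : 2 `^ (- P) <= Pe.
  by rewrite -[leRHS]pow2_log2// ler_pow2// lerNl le_max lexx orbT.
have [c c0 choice] := choose_parameters a rho0 C10 P2.
exists c => // W bW H d /andP[d0 d1].
set l := log2 (4 / d).
have dl : d = 4 * 2 `^ (- l).
  rewrite /l powRN pow2_log2 ?divr_gt0//.
  by rewrite invf_div mulrCA divff ?mulr1// pnatr_eq0.
have lE : l = 2 + log2 d^-1.
  rewrite /l log2M ?invr_gt0// (_ : 4 = 2 ^+ 2); last by ring.
  by rewrite log2X// log2_2 mulr1.
have l2 : 2 <= l.
  by rewrite lE lerDl log2_ge0// invf_ge1// ltW.
have [m [n [K [mn lm uK decay_exp]]]] := choice _ l2.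
set N1 : R := n.+1%:R; set u := log2 N1.
have N10 : 0 < N1 by rewrite ltr0n.
have N1X k : N1 ^+ k = 2 `^ (u * k%:R).
  by rewrite powRrM pow2_log2// powR_mulrn// ltW.
have two_X k : 2 ^+ k = 2 `^ k%:R :> R by rewrite powR_mulrn.
exists (m + n)%N; split.
  by apply: le_trans mn _; rewrite lE addrAC subrr add0r.
have cap := capacity_le_good k0 a_gt0 ak m n K bW.
have bad := sum_not_extreme m n.+1 alpha0 beta0 rho0 bW H.
rewrite -/kappa -/C0 in bad.
have d4 : d / 4 = 2 `^ (- l) by rewrite dl mulrAC divff ?mul1r// pnatr_eq0.
have bad_d : C0 * 2 `^ (- (rho * m%:R)) <= d / 4.
  apply: le_trans (ler_wpM2r (pow2_ge0 _) C0C1) _.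
  rewrite -pow2D d4 ler_pow2//; move: lm; lra.
have cnt_d : 2 * ((n.+1 ^ K)%:R / (2 ^ n)%:R) <= d / 4.
  rewrite !natrX -/N1 N1X two_X -powRN -pow2D.
  rewrite -[X in X * _](@powRr1 _ 2)// -pow2D.
  by rewrite d4 ler_pow2//; move: uK; rewrite -/N1 -/u; lra.
have dec_d : 4 * decay a n K <= d / 4.
  rewrite d4 /decay -/N1 (_ : 4 = 2 `^ 2%:R); last first.
    by rewrite powR_mulrn//; ring.
  rewrite -pow2D ler_pow2//.
  have u0 : 0 <= u * K%:R by rewrite mulr_ge0// log2_ge0// ler1n.
  by move: decay_exp uK; rewrite -/N1 -/u; have := ler0n R m; lra.
have dec_Pe : decay a n K <= Pe / (2 ^ (m + n))%:R.
  rewrite natrX two_X -powRN natrD.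
  apply: (@le_trans _ _ (2 `^ (- P) * 2 `^ (- (m%:R + n%:R)))); last first.
    by rewrite ler_wpM2r ?pow2_ge0.
  by rewrite -pow2D ler_pow2// /decay -/N1; move: decay_exp; rewrite -/N1; lra.
rewrite lerBlDr; apply: le_trans cap _.
have : avg (m + n) (fun s =>
      (bhattacharyya (polarized W s) <= decay a n K)%R%:R) <=
    avg (m + n) (fun s =>
      (bhattacharyya (polarized W s) <= Pe / (2 ^ (m + n))%:R)%R%:R) :> R.
  apply: le_avg => t _; rewrite ler_nat.
  by case: (leP _ (decay a n K)) => //= /le_trans/(_ dec_Pe) ->.
lra.
Qed.

End BlockLength.

(** * Bit channels as seen by the decoder *)

Section Halves.
Variable n : nat.
Local Notation N := (2 ^ n)%N.

Fact half_index_subproof (b : bool) (k : 'I_N) : (b * 2 ^ n + k < 2 ^ n.+1)%N.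
Proof.
rewrite expnS mul2n -addnn; case: b; first by rewrite mul1n ltn_add2l.
by rewrite mul0n add0n ltn_addl.
Qed.

(** The index with most significant bit [b] and remaining bits [k]: the first transform applied is
    governed by [b], so inductions on [n] split indices in this way. *)
Definition half_index (b : bool) (k : 'I_N) : 'I_(2 ^ n.+1) :=
  Ordinal (half_index_subproof b k).

Fact index_rest_subproof (i : 'I_(2 ^ n.+1)) : (i %% 2 ^ n < 2 ^ n)%N.
Proof. by rewrite ltn_mod expn_gt0. Qed.

Definition index_rest (i : 'I_(2 ^ n.+1)) : 'I_N :=
  Ordinal (index_rest_subproof i).

Definition index_top (i : 'I_(2 ^ n.+1)) : bool := (2 ^ n <= i)%N.

Lemma half_index_top b k : index_top (half_index b k) = b.
Proof.
rewrite /index_top /=; case: b; first by rewrite mul1n leq_addr.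
by rewrite mul0n add0n leqNgt ltn_ord.
Qed.

Lemma half_index_rest b k : index_rest (half_index b k) = k.
Proof. by apply: val_inj; rewrite /= modnMDl modn_small. Qed.

Lemma half_indexK i : half_index (index_top i) (index_rest i) = i.
Proof.
apply: val_inj; rewrite /= /index_top.
have := ltn_ord i; rewrite [X in (_ < X)%N -> _]expnS mul2n -addnn => iN.
case: leqP => iN'; last by rewrite mul0n modn_small.
move: (nat_of_ord i) iN iN' => x xN xN'.
rewrite mul1n -{1}(subnKC xN') modnDl modn_small ?subnKC//.
by rewrite ltn_subLR.
Qed.

Lemma half_indexP (P : 'I_(2 ^ n.+1) -> Prop) :
  (forall b k, P (half_index b k)) -> forall i, P i.
Proof. by move=> Pbk i; rewrite -(half_indexK i). Qed.

Lemma big_half_index (T : Type) (idx : T) (op : Monoid.com_law idx)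
    (F : 'I_(2 ^ n.+1) -> T) :
  \big[op/idx]_i F i =
  op (\big[op/idx]_(k < N) F (half_index false k))
     (\big[op/idx]_(k < N) F (half_index true k)).
Proof.
rewrite (reindex (fun p => half_index p.1 p.2)); last first.
  exists (fun i => (index_top i, index_rest i)) => [[b k] _|i _] /=.
    by rewrite half_index_top half_index_rest.
  exact: half_indexK.
rewrite -(pair_bigA _ (fun b k => F (half_index b k)))/= big_bool/=.
by rewrite Monoid.mulmC.
Qed.

Lemma half_index_ltn b c j k :
  (half_index b j < half_index c k)%N = if b == c then (j < k)%N else c && ~~ b.
Proof.
case: b c => -[] /=; rewrite ?mul1n ?mul0n ?add0n ?ltn_add2l//.
  by rewrite ltnNge (leq_trans (ltnW (ltn_ord k)))// leq_addr.
by rewrite (leq_trans (ltn_ord j))// leq_addr.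
Qed.

Definition half (b : bool) (u : 'rV[bool]_(2 ^ n.+1)) : 'rV[bool]_N :=
  \row_k u 0 (half_index b k).

Definition join (u0 u1 : 'rV[bool]_N) : 'rV[bool]_(2 ^ n.+1) :=
  \row_i (if index_top i then u1 else u0) 0 (index_rest i).

Lemma half_join b u0 u1 : half b (join u0 u1) = if b then u1 else u0.
Proof.
by apply/rowP => k; rewrite !mxE half_index_top half_index_rest; case: b.
Qed.

Lemma join_half u : join (half false u) (half true u) = u.
Proof.
apply/rowP => i; rewrite mxE -[in RHS](half_indexK i).
by case: index_top; rewrite mxE.
Qed.

Lemma joinE u0 u1 b k :
  join u0 u1 0 (half_index b k) = (if b then u1 else u0) 0 k.
Proof. by rewrite mxE half_index_top half_index_rest. Qed.

Lemma big_join (T : Type) (idx : T) (op : Monoid.com_law idx)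
    (P : pred 'rV[bool]_(2 ^ n.+1)) (F : 'rV[bool]_(2 ^ n.+1) -> T) :
  \big[op/idx]_(w | P w) F w =
  \big[op/idx]_(w0 : 'rV[bool]_N)
    \big[op/idx]_(w1 | P (join w0 w1)) F (join w0 w1).
Proof.
rewrite pair_big_dep/= (reindex (fun p => join p.1 p.2))//.
exists (fun u => (half false u, half true u)) => [[u0 u1] _|u _] /=.
  by rewrite !half_join.
exact: join_half.
Qed.

End Halves.

Lemma binary_half_index n b (k : 'I_(2 ^ n)) :
  binary n.+1 (half_index b k) = b :: binary n k.
Proof.
rewrite /binary /= subn1 /=; congr (_ :: _).
  by rewrite divnMDl ?expn_gt0// divn_small// addn0; case: b.
have -> : iota 2 n = map (addn 1) (iota 1 n) by rewrite -iotaDl.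
rewrite -map_comp; apply/eq_in_map => j.
rewrite mem_iota => /andP[j1 jn] /=; rewrite add1n subSS.
have jn' : (j <= n)%N by rewrite -ltnS -add1n.
rewrite -{1}(subnKC jn') expnD mulnA divnMDl ?expn_gt0//.
by rewrite oddD oddM oddX /= gtn_eqF// andbF.
Qed.

(** * Block structure of the encoder *)

Section Encoding.
Implicit Types n : nat.

Lemma polar_matrix_half n b c (j k : 'I_(2 ^ n)) :
  polar_matrix n.+1 (half_index b j) (half_index c k) =
  (c ==> b) && polar_matrix n j k.
Proof.
(* The Kronecker power of exponent 1 is the kernel itself, with an equation of its own. *)
case: n j k => [|n] j k.
  have j0 : j = 0%N :> nat by case: j => -[].
  have k0 : k = 0%N :> nat by case: k => -[].
  rewrite /polar_matrix ntensmx1 ntensmx0 !mxE /= j0 k0 !addn0.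
  by rewrite -val_eqE /= j0 k0; case: b c => -[].
rewrite /polar_matrix ntensmxSS mxE; congr (_ && _).
  rewrite mxE /= !divnMDl ?expn_gt0// !divn_small// !addn0.
  by case: b c => -[].
by congr (_ _ _); apply: val_inj; rewrite /= modnMDl modn_small.
Qed.

Definition encode n (u : 'rV[bool]_(2 ^ n)) : 'rV[bool]_(2 ^ n) :=
  u *m polar_matrix n.

(** The block form of the generator matrix: (u0, u1) is sent to the codewords of u0 + u1 and u1. *)
Lemma half_encode n b (u : 'rV[bool]_(2 ^ n.+1)) : half b (encode u) =
  if b then encode (half true u)
  else encode (half false u) + encode (half true u).
Proof.
apply/rowP => k; rewrite !mxE big_half_index /=.
case: b; rewrite ?mxE.
  rewrite [X in X + _]big1 ?add0r => [|j _].
    by apply: eq_bigr => j _; rewrite polar_matrix_half mxE.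
  by rewrite polar_matrix_half mulr0.
by congr (_ + _); apply: eq_bigr => j _; rewrite polar_matrix_half mxE.
Qed.

Lemma encodeD n : {morph @encode n : u v / u + v}.
Proof. by move=> u v; rewrite /encode mulmxDl. Qed.

Lemma rowDD n (u : 'rV[bool]_n) : u + u = 0.
Proof. by apply/rowP => i; rewrite !mxE; case: (u 0 i). Qed.

Lemma encodeK n : involutive (@encode n).
Proof.
elim: n => [|n IH] u; first by rewrite /encode /polar_matrix ntensmx0 !mulmx1.
rewrite -[RHS]join_half -[LHS]join_half !half_encode !encodeD !IH.
by rewrite -addrA rowDD addr0.
Qed.

End Encoding.

(** * Bit likelihoods under one transform *)

Section Recursion.
Local Open Scope classical_set_scope.
Local Open Scope ring_scope.
Context {R : realType}.
Implicit Types W : channel R.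

Definition agree_before n (i : 'I_(2 ^ n)) (w u : 'rV[bool]_(2 ^ n)) : bool :=
  [forall j : 'I_(2 ^ n), (j < i)%N ==> (w 0 j == u 0 j)].

Lemma agree_before_low n (i : 'I_(2 ^ n)) w u :
  agree_before (half_index false i) w u =
  agree_before i (half false w) (half false u).
Proof.
apply/forallP/forallP => [H k|H].
  by have := H (half_index false k); rewrite half_index_ltn !mxE.
apply: half_indexP => -[] k; rewrite half_index_ltn//=.
by have := H k; rewrite !mxE.
Qed.

Lemma agree_before_high n (i : 'I_(2 ^ n)) w u :
  agree_before (half_index true i) w u =
  (half false w == half false u) && agree_before i (half true w) (half true u).
Proof.
apply/forallP/andP => [H|[/eqP/rowP H0 /forallP H1]].
  split.
    apply/eqP/rowP => k; rewrite !mxE; apply/eqP.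
    by have := H (half_index false k); rewrite half_index_ltn.
  apply/forallP => k.
  by have := H (half_index true k); rewrite half_index_ltn !mxE.
apply: half_indexP => -[] k; rewrite half_index_ltn /=.
  by have := H1 k; rewrite !mxE.
by have := H0 k; rewrite !mxE => ->.
Qed.

Lemma bit_likelihoodE W n (i : 'I_(2 ^ n)) y u v :
  @bit_likelihood R W n i y u v = 2 ^- (2 ^ n).-1 *
  \sum_(w | agree_before i w u && (w 0 i == v)) likelihood y w.
Proof. by []. Qed.

(** The positions [k] and [2 ^ n + k] carry x1 + x2 and x2 for the bits number [k] of the codewords
    of the two halves; their outputs form one output of the step 0. *)
Definition pair_outputs W n (y : {ffun 'I_(2 ^ n.+1) -> output W}) :
    {ffun 'I_(2 ^ n) -> output (minus_transform W)} :=
  [ffun k => (y (half_index false k), y (half_index true k))].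

(** The row [v] is the codeword of the first half, already decided: its bits are the extra outputs
    of the step 1. *)
Definition pair_outputs_known W n (y : {ffun 'I_(2 ^ n.+1) -> output W})
    (v : 'rV[bool]_(2 ^ n)) : {ffun 'I_(2 ^ n) -> output (plus_transform W)} :=
  [ffun k => ((y (half_index false k), y (half_index true k)), v 0 k)].

Lemma pair_outputsE W n y k : @pair_outputs W n y k =
  (y (half_index false k), y (half_index true k)).
Proof. exact: ffunE. Qed.

Lemma pair_outputs_knownE W n y v k : @pair_outputs_known W n y v k =
  (y (half_index false k), y (half_index true k), v 0 k).
Proof. exact: ffunE. Qed.

Lemma likelihood_join W n (y : {ffun 'I_(2 ^ n.+1) -> output W}) u0 u1 :
  likelihood y (join u0 u1) =
  \prod_k (W (y (half_index false k)) (encode u0 0 k + encode u1 0 k) *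
           W (y (half_index true k)) (encode u1 0 k)).
Proof.
rewrite /likelihood big_half_index /= -big_split; apply: eq_bigr => k _ /=.
have h b : (join u0 u1 *m polar_matrix n.+1) 0 (half_index b k) =
    half b (encode (join u0 u1)) 0 k by rewrite !mxE.
by rewrite !h !half_encode !half_join mxE.
Qed.

Lemma likelihood_plus W n (y : {ffun 'I_(2 ^ n.+1) -> output W}) u0 u1 :
  likelihood (pair_outputs_known y (encode u0)) u1 =
  2 ^- (2 ^ n) * likelihood y (join u0 u1).
Proof.
rewrite likelihood_join /likelihood.
rewrite -exprVn -[X in _ ^+ X]card_ord -prodr_const -big_split /=.
by apply: eq_bigr => k _; rewrite pair_outputs_knownE /= mulrA addrC.
Qed.

Lemma row_prod_sum n (g : 'I_n -> bool -> R) :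
  \sum_(v : 'rV[bool]_n) \prod_k g k (v 0 k) = \prod_k \sum_b g k b.
Proof.
rewrite bigA_distr_bigA/= (reindex (fun f : {ffun 'I_n -> bool} => \row_k f k)).
  by apply: eq_bigr => f _; apply: eq_bigr => k _; rewrite mxE.
exists (fun v : 'rV[bool]_n => [ffun k => v 0 k]) => [f _|v _].
  by apply/ffunP => k; rewrite ffunE mxE.
by apply/rowP => k; rewrite mxE ffunE.
Qed.

(** As [encode] is a bijection, the sum over [u1] may run over codewords; it then distributes over
    the positions, each one giving the sum over x2 of the step 0. *)
Lemma likelihood_minus W n (y : {ffun 'I_(2 ^ n.+1) -> output W}) u0 :
  likelihood (pair_outputs y) u0 =
  2 ^- (2 ^ n) * \sum_u1 likelihood y (join u0 u1).
Proof.
under eq_bigr do rewrite likelihood_join.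
rewrite (reindex_inj (inv_inj (@encodeK n)))/=.
under eq_bigr do rewrite encodeK.
rewrite (row_prod_sum (fun k b =>
   W (y (half_index false k)) (encode u0 0 k + b) *
   W (y (half_index true k)) b)).
rewrite -exprVn -[X in _ ^+ X]card_ord -prodr_const -big_split /=.
apply: eq_bigr => k _; rewrite pair_outputsE /= mulr_sumr.
by apply: eq_bigr => b _; rewrite mulrA.
Qed.

Lemma pow2_predD n : (2 ^ n.+1).-1 = (2 ^ n + (2 ^ n).-1)%N.
Proof. by rewrite expnS mul2n -addnn -{2}(prednK (expn_gt0 2 n)) addnS. Qed.

(** All indices of the second half come after [i], so that half is summed freely, as in
    [likelihood_minus]. *)
Lemma bit_likelihood_low W n (i : 'I_(2 ^ n)) y u v :
  @bit_likelihood R W n.+1 (half_index false i) y u v =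
  @bit_likelihood R (minus_transform W) n i (pair_outputs y) (half false u) v.
Proof.
rewrite !bit_likelihoodE pow2_predD exprD invfM -mulrA mulrCA; congr (_ * _).
under [RHS]eq_bigr do rewrite likelihood_minus.
rewrite -mulr_sumr; congr (_ * _); rewrite big_join [RHS]big_mkcond /=.
apply: eq_bigr => w0 _.
under eq_bigl do rewrite agree_before_low half_join joinE.
by case: ifP => // _; rewrite big_pred0.
Qed.

(** All indices of the first half come before [i], so the prefix condition leaves a single term for
    that half. *)
Lemma bit_likelihood_high W n (i : 'I_(2 ^ n)) y u v :
  @bit_likelihood R W n.+1 (half_index true i) y u v =
  @bit_likelihood R (plus_transform W) n i
    (pair_outputs_known y (encode (half false u))) (half true u) v.
Proof.
rewrite !bit_likelihoodE pow2_predD exprD invfM -mulrA mulrCA; congr (_ * _).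
under [RHS]eq_bigr do rewrite likelihood_plus.
rewrite -mulr_sumr; congr (_ * _).
rewrite big_join /= (bigD1 (half false u))//=.
rewrite [X in _ + X]big1 ?addr0 => [|w0 /negPf ne].
  by apply: eq_bigl => w1; rewrite agree_before_high !half_join eqxx joinE.
by apply: big_pred0 => w1; rewrite agree_before_high half_join ne.
Qed.

(** Selects one row for each prefix u_0, ..., u_(i-1), so that prefixes need no type of their
    own. *)
Definition zero_after n (i : 'I_(2 ^ n)) (u : 'rV[bool]_(2 ^ n)) : bool :=
  [forall j : 'I_(2 ^ n), (i <= j)%N ==> (u 0 j == 0)].

Lemma zero_after_low n (i : 'I_(2 ^ n)) u0 u1 :
  zero_after (half_index false i) (join u0 u1) = zero_after i u0 && (u1 == 0).
Proof.
apply/forallP/andP => [H|[/forallP H0 /eqP -> ]].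
  split.
    apply/forallP => k; have := H (half_index false k).
    by rewrite joinE leqNgt half_index_ltn /= -leqNgt.
  apply/eqP/rowP => k; have := H (half_index true k).
  by rewrite joinE leqNgt half_index_ltn mxE => /eqP.
apply: half_indexP => -[] k; rewrite joinE ?mxE ?eqxx ?implybT//.
by rewrite leqNgt half_index_ltn /= -leqNgt.
Qed.

Lemma zero_after_high n (i : 'I_(2 ^ n)) u0 u1 :
  zero_after (half_index true i) (join u0 u1) = zero_after i u1.
Proof.
apply/forallP/forallP => [H k|H].
  have := H (half_index true k).
  by rewrite joinE leqNgt half_index_ltn /= -leqNgt.
apply: half_indexP => -[] k; rewrite joinE leqNgt half_index_ltn//= -leqNgt.
exact: H.
Qed.

Local Open Scope ereal_scope.

Lemma pair_outputs_bij W n :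
  exists e : {ffun 'I_(2 ^ n) -> output (minus_transform W)} ->
  {ffun 'I_(2 ^ n.+1) -> output W}, cancel (@pair_outputs W n) e /\
  cancel e (@pair_outputs W n).
Proof.
exists (fun y => [ffun i => if index_top i then (y (index_rest i)).2
                       else (y (index_rest i)).1]); split=> y.
  apply/ffunP; apply: half_indexP => b k.
  by rewrite !ffunE half_index_top half_index_rest; case: b.
apply/ffunP => k; rewrite !ffunE !half_index_top !half_index_rest.
by rewrite -surjective_pairing.
Qed.

Definition unpair_outputs_known W n
    (z : {ffun 'I_(2 ^ n) -> output (plus_transform W)}) :
    {ffun 'I_(2 ^ n.+1) -> output W} * 'rV[bool]_(2 ^ n) :=
  ([ffun i => if index_top i then (z (index_rest i)).1.2
                       else (z (index_rest i)).1.1], \row_k (z k).2).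

Lemma pair_outputs_knownK W n :
  cancel (fun p => @pair_outputs_known W n p.1 p.2) (@unpair_outputs_known W n).
Proof.
move=> [y v]; congr (_, _) => /=.
  apply/ffunP; apply: half_indexP => b k.
  by rewrite !ffunE half_index_top half_index_rest; case: b.
by apply/rowP => k; rewrite mxE ffunE.
Qed.

Lemma unpair_outputs_knownK W n :
  cancel (@unpair_outputs_known W n) (fun p => @pair_outputs_known W n p.1 p.2).
Proof.
move=> z; apply/ffunP => k; rewrite pair_outputs_knownE /= !ffunE mxE.
by rewrite !half_index_top !half_index_rest; case: (z k) => -[].
Qed.

(** The recursive bit channel and the one of the decoder agree up to relabeling of outputs,
    expressed through sums of functions of the pair of likelihoods. The induction peels off the
    first transform. *)
Lemma esum_bit_channel W n (i : 'I_(2 ^ n)) (f : R -> R -> \bar R) :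
  (forall p q, 0 <= f p q) ->
  \esum_(o in [set: output (bit_channel W i)])
    f (bit_channel W i o false) (bit_channel W i o true) =
  \esum_(y in [set: {ffun 'I_(2 ^ n) -> output W}])
    \sum_(u | zero_after i u)
      f (bit_likelihood i y u false) (bit_likelihood i y u true).
Proof.
move=> f0; elim: n W i => [|n IH] W i.
  have i0 : i = ord0 :> 'I_1 by exact: ord1.
  pose e (y : {ffun 'I_(2 ^ 0) -> output W}) := y i.
  pose e' (o : output W) : {ffun 'I_(2 ^ 0) -> output W} := [ffun=> o].
  have eK : cancel e e'.
    by move=> y; apply/ffunP => j; rewrite ffunE /e (ord1 i) (ord1 j).
  have e'K : cancel e' e by move=> o; rewrite /e ffunE.
  rewrite (reindex_esumT _ eK e'K); apply: eq_esum => y _.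
  rewrite (big_pred1 (0%R : 'rV[bool]_(2 ^ 0))) => [|u]; last first.
    apply/forallP/eqP => [H|->]; last by move=> j; rewrite mxE eqxx implybT.
    by apply/rowP => j; have := H j; rewrite (ord1 i) (ord1 j) mxE => /eqP.
  have bl v : bit_likelihood i y 0 v = W (e y) v.
    rewrite bit_likelihoodE expr0 invr1 mul1r.
    rewrite (big_pred1 (const_mx v : 'rV[bool]_(2 ^ 0))) => [|w].
      rewrite /likelihood (bigD1 i)//= big1 ?mulr1 => [|j].
        by rewrite /polar_matrix ntensmx0 mulmx1 mxE.
      by rewrite (ord1 i) (ord1 j) eqxx.
    have -> : agree_before i w 0.
      by apply/forallP => j; rewrite (ord1 i) (ord1 j).
    apply/eqP/eqP => [<-|->]; last by rewrite mxE.
    by apply/rowP => j; rewrite mxE (ord1 i) (ord1 j).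
  by rewrite !bl.
move: i; apply: half_indexP => b i.
rewrite /bit_channel binary_half_index /=; case: b; rewrite -/(bit_channel _ i).
  rewrite IH.
  rewrite (reindex_esumT _ (@pair_outputs_knownK W n)
                           (@unpair_outputs_knownK W n)).
  rewrite esum_prod; last by move=> p; rewrite sume_ge0.
  apply: eq_esum => y _.
  rewrite esum_fintype; last by move=> p; rewrite sume_ge0.
  (* The extra outputs range over all rows, that is over the codewords of all first halves. *)
  rewrite (reindex_inj (inv_inj (@encodeK n)))/= big_join.
  apply: eq_bigr => u0 _.
  apply: eq_big => u1; first by rewrite zero_after_high.
  by rewrite !bit_likelihood_high !half_join.
have [e [eK e'K]] := pair_outputs_bij W n.
rewrite IH (reindex_esumT _ eK e'K); apply: eq_esum => y _.
rewrite big_join big_mkcond /=; apply: eq_bigr => u0 _.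
under eq_bigl do rewrite zero_after_low.
case: ifP => _; last by rewrite big_pred0.
by rewrite big_pred1_eq !bit_likelihood_low !half_join.
Qed.

End Recursion.

(** * Error probability of successive cancellation *)

Lemma card_half (T : finType) (s : T -> T) (P : pred T) :
  involutive s -> (forall x, P (s x) = ~~ P x) -> (#|P| * 2 = #|T|)%N.
Proof.
move=> sK Ps; rewrite -(cardC P) muln2 -addnn; congr (_ + _)%N.
rewrite -!sum1_card (reindex_inj (inv_inj sK)); apply: eq_bigl => x.
by rewrite !inE unfold_in Ps.
Qed.

Section ErrorAnalysis.
Local Open Scope classical_set_scope.
Local Open Scope ring_scope.
Context {R : realType}.
Variables (W : channel R) (n : nat).
Hypothesis bW : is_BMS W.
Local Notation N := (2 ^ n)%N.
Implicit Types (u w : 'rV[bool]_N) (i : 'I_N) (y : {ffun 'I_N -> output W}).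

(* Probability that a maximum likelihood decision is wrong, when [p] is the
   likelihood of the right value and [q] that of the other one. *)
Definition wrong (p q : R) : R := (p < q)%R%:R + 2^-1 * (q == p)%:R.

Lemma wrong_ge0 p q : 0 <= wrong p q.
Proof. by rewrite addr_ge0// mulr_ge0// invr_ge0. Qed.

Lemma likelihood_ge0 y u : 0 <= likelihood y u.
Proof. by apply: prodr_ge0 => k _; exact: BMS_ge0. Qed.

Lemma bit_likelihood_ge0 i y u v : 0 <= bit_likelihood i y u v.
Proof.
rewrite bit_likelihoodE mulr_ge0 ?invr_ge0 ?exprn_ge0//.
by apply: sumr_ge0 => w _; exact: likelihood_ge0.
Qed.

Lemma agree_before_trans i w u u' :
  agree_before i u u' -> agree_before i w u = agree_before i w u'.
Proof.
move=> /forallP uu'; apply: eq_forallb => j.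
by case: (ltnP j i) => //= ji; have := uu' j; rewrite ji => /eqP ->.
Qed.

Lemma bit_likelihood_prefix i y u u' v :
  agree_before i u u' -> bit_likelihood i y u v = bit_likelihood i y u' v.
Proof.
move=> uu'; rewrite !bit_likelihoodE; congr (_ * _).
by apply: eq_bigl => w; rewrite (agree_before_trans _ uu').
Qed.

(** Weight of an error at step [i], averaged over the tie coin, for a decoder that is told the true
    previous bits of the message [u]. *)
Definition genie_error i y u : R :=
  likelihood y u * wrong (bit_likelihood i y u (u 0 i))
                         (bit_likelihood i y u (~~ u 0 i)).

Lemma genie_error_ge0 i y u : 0 <= genie_error i y u.
Proof. by rewrite mulr_ge0 ?likelihood_ge0 ?wrong_ge0. Qed.

(* Adding [a] to the message amounts to applying the symmetry of [W] to the
   outputs at the positions where the codeword of [a] is 1. *)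
Lemma esum_genie_error_const i u u' :
  (\esum_(y in [set: {ffun 'I_N -> output W}]) (genie_error i y u)%:E =
   \esum_(y in [set: {ffun 'I_N -> output W}]) (genie_error i y u')%:E)%E.
Proof.
have [pi [piK Wpi]] := BMS_flip bW.
pose a := u + u'; have ua : u' = u + a by rewrite addrA rowDD add0r.
pose tau y : {ffun 'I_N -> output W} :=
  [ffun k => if encode a 0 k then pi (y k) else y k].
have tauK : involutive tau.
  move=> y; apply/ffunP => k; rewrite !ffunE.
  by case: (encode a 0 k); rewrite ?piK.
have L y w : likelihood (tau y) (w + a) = likelihood y w.
  apply: eq_bigr => k _.
  rewrite ffunE -!/(encode _) encodeD [(encode w + _) 0 k]mxE.
  by case: (encode a 0 k); rewrite ?Wpi; case: (encode w 0 k).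
have B y v : bit_likelihood i (tau y) (u + a) (v + a 0 i) =
    bit_likelihood i y u v.
  rewrite !bit_likelihoodE; congr (_ * _).
  rewrite (reindex_inj (addIr a)); apply: eq_big => [w|w _]; last exact: L.
  rewrite mxE (inj_eq (addIr _)); congr (_ && _).
  by apply: eq_forallb => j; rewrite !mxE (inj_eq (addIr _)).
rewrite [RHS](reindex_esumT _ tauK tauK); apply: eq_esum => y _.
rewrite /genie_error ua L -B; congr (_ * wrong _ _)%:E.
  by congr (bit_likelihood _ _ _ _); rewrite [RHS]mxE.
rewrite -B; congr (bit_likelihood _ _ _ _); rewrite [(u + a) 0 i]mxE.
by case: (u 0 i) (a 0 i) => -[].
Qed.

Definition prefix_part i u : 'rV[bool]_N := \row_j ((j < i)%N && u 0 j).

(** Messages are grouped by their first [i] bits: [wrong] depends only on these, and the likelihoods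
    of a group add up to a bit likelihood. The bit [i] is 1 because [error_prob] is taken at the
    input 1. *)
Lemma genie_error_prefix i y :
  \sum_(p | zero_after i p) `|bit_likelihood i y p true| *
     wrong (bit_likelihood i y p true) (bit_likelihood i y p false) =
  2 ^- N.-1 * \sum_(w : 'rV[bool]_N | w 0 i) genie_error i y w.
Proof.
rewrite [in RHS](partition_big (prefix_part i) (zero_after i))/=; last first.
  by move=> w _; apply/forallP => j; rewrite mxE ltnNge; case: (_ <= _)%N.
rewrite mulr_sumr; apply: eq_bigr => p zp.
rewrite ger0_norm ?bit_likelihood_ge0// [X in X * _]bit_likelihoodE.
rewrite -mulrA mulr_suml.
congr (_ * _); apply: eq_big => w.
  rewrite eqb_id andbC; congr (_ && _).
  apply/forallP/eqP => [wp|<- j]; last first.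
    by rewrite mxE; case: ltnP => //= _; exact/eqP.
  apply/rowP => j; rewrite mxE; case: ltnP => ji /=.
    by have := wp j; rewrite ji => /eqP.
  by have /forallP/(_ j) := zp; rewrite ji => /eqP ->.
move=> /andP[wp /eqP wi]; rewrite /genie_error wi /=.
by rewrite !(bit_likelihood_prefix _ _ wp).
Qed.

Lemma sum_half_rows i : \sum_(w : 'rV[bool]_N | w 0 i) 2 ^- N.-1 = 1 :> R.
Proof.
have : (#|[pred w : 'rV[bool]_N | w 0%R i]| * 2 = 2 ^ N)%N.
  rewrite (@card_half _ (fun w => w + \row_j (j == i))).
  - by rewrite card_mx card_bool mul1n.
  - by move=> w; rewrite -addrA rowDD addr0.
  - by move=> w; rewrite /= !mxE eqxx; case: (w 0 i).
have -> : (2 ^ N = 2 ^ N.-1 * 2)%N by rewrite -expnSr prednK// expn_gt0.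
move=> /eqP; rewrite eqn_pmul2r// => /eqP e.
rewrite sumr_const -[X in _ *+ X]/(#|[pred w : 'rV[bool]_N | w 0%R i]|) e.
by rewrite -[LHS]mulr_natl natrX mulfV// expf_neq0.
Qed.

(** The error probability is the average of the genie error over the 2^(N-1) messages with bit [i]
    equal to 1; by symmetry all messages have the same genie error. *)
Lemma esum_genie_error i u :
  (\esum_(y in [set: {ffun 'I_N -> output W}]) (genie_error i y u)%:E =
   (error_prob (bit_channel W i))%:E)%E.
Proof.
have bWi : is_BMS (bit_channel W i) by exact: polarized_BMS.
(* The absolute value makes [f] nonnegative on all reals, as [esum_bit_channel] demands; it
   disappears on likelihoods. *)
pose f (p q : R) := (`|q| * wrong q p)%:E.
have f0 p q : (0 <= f p q)%E by rewrite lee_fin mulr_ge0// wrong_ge0.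
have [_ <-] := has_sum_error_prob bWi.
have := esum_bit_channel W i f0.
under [X in X = _ -> _]eq_esum do rewrite /f /wrong ger0_norm ?BMS_ge0//.
move=> ->.
have c0 : 0 <= 2 ^- N.-1 :> R by rewrite invr_ge0 exprn_ge0.
transitivity (\esum_(y in [set: {ffun 'I_N -> output W}])
   \sum_(w : 'rV[bool]_N | w 0%R i)
     ((2 ^- N.-1)%:E * (genie_error i y w)%:E))%E; last first.
  apply: eq_esum => y _.
  transitivity
    (2 ^- N.-1 * \sum_(w : 'rV[bool]_N | w 0 i) genie_error i y w)%:E.
    rewrite EFinM -sumEFin ge0_sume_distrr// => w _.
    by rewrite lee_fin genie_error_ge0.
  by rewrite -genie_error_prefix -sumEFin.
rewrite esum_sum; last first.
  by move=> y w _ _; rewrite mule_ge0// lee_fin ?genie_error_ge0.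
under eq_bigr => w _.
  rewrite ge0_esumZl//; last by move=> y; rewrite lee_fin genie_error_ge0.
  rewrite (esum_genie_error_const i w u); over.
rewrite -ge0_sume_distrl; last by move=> w _; rewrite lee_fin.
by rewrite sumEFin sum_half_rows mul1e.
Qed.

Variable A : {set 'I_N}.
Implicit Type t : {ffun 'I_N -> bool}.

Lemma sc_decision_prefix y t i u u' : agree_before i u u' ->
  sc_decision A y t u i = sc_decision A y t u' i.
Proof.
by move=> uu'; rewrite /sc_decision !(bit_likelihood_prefix _ _ uu').
Qed.

(** A decision depends only on the previous bits, so as long as these are right it coincides with
    the decision made from [u] itself. *)
Lemma sc_decode_correct y t u : is_message A u ->
  (forall i, i \in A -> sc_decision A y t u i = u 0 i) -> sc_decode A y t = u.
Proof.
move=> /forallP msg ok.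
have {}ok i : sc_decision A y t u i = u 0 i.
  case: (boolP (i \in A)) => [/ok//|iA].
  by rewrite /sc_decision iA; have := msg i; rewrite iA => /negPf ->.
pose step u' i := \row_j (if j == i then sc_decision A y t u' i else u' 0 j).
(* Invariant: after [k] steps the first [k] entries of the accumulator are those of [u]. *)
have inv k : (k <= N)%N -> forall j : 'I_N, (j < k)%N ->
    foldl step 0 (take k (enum 'I_N)) 0 j = u 0 j.
  elim: k => // k IH kN j; rewrite ltnS leq_eqVlt.
  rewrite (take_nth (Ordinal kN)) ?size_enum_ord// foldl_rcons.
  rewrite [nth _ _ _](_ : _ = Ordinal kN); last first.
    by apply: val_inj; rewrite /= nth_enum_ord.
  rewrite {1}/step mxE -val_eqE /=; case: eqP => [jk _|_ /= jk].
    have -> : j = Ordinal kN by exact: val_inj.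
    rewrite -ok; apply: sc_decision_prefix; apply/forallP => l.
    by apply/implyP => lk; rewrite IH// ltnW.
  by rewrite IH// ltnW.
apply/rowP => j; rewrite -(inv N)// take_oversize// size_enum_ord//.
Qed.

Lemma coin_average i b :
  \sum_(t : {ffun 'I_N -> bool}) 2 ^- N * (t i != b)%:R = 2^-1 :> R.
Proof.
have h := @card_half {ffun 'I_N -> bool}
  (fun t => [ffun j => ~~ t j]) (fun t => t i != b).
rewrite -mulr_sumr.
have -> : \sum_(t : {ffun 'I_N -> bool}) (t i != b)%:R =
    #|(fun t : {ffun 'I_N -> bool} => t i != b)|%:R :> R.
  rewrite -sum1_card natr_sum [RHS]big_mkcond; apply: eq_bigr => t _.
  by rewrite unfold_in; case: (_ != _).
have : (#|(fun t : {ffun 'I_N -> bool} => t i != b)| * 2 = 2 ^ N)%N.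
  rewrite h ?card_ffun ?card_bool ?card_ord// => t.
    by apply/ffunP => j; rewrite !ffunE negbK.
  have negb_neq (x c : bool) : (~~ x != c) = ~~ (x != c) by case: x c => -[].
  by rewrite ffunE negb_neq.
move=> /(congr1 (fun k => k%:R : R)); rewrite natrM natrX => e.
have N0 : 2 ^+ N != 0 :> R by rewrite expf_neq0.
by rewrite -e in N0 *; field; move: N0; rewrite mulf_eq0 negb_or => /andP[].
Qed.

(** The coin intervenes only in a tie, where it errs with probability 1/2; this is the weight of a
    tie in [wrong]. *)
Lemma decision_average y i u : i \in A ->
  \sum_(t : {ffun 'I_N -> bool}) 2 ^- N * (sc_decision A y t u i != u 0 i)%:R =
  wrong (bit_likelihood i y u (u 0 i)) (bit_likelihood i y u (~~ u 0 i)).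
Proof.
move=> iA; have cst (b : bool) :
    \sum_(t : {ffun 'I_N -> bool}) 2 ^- N * b%:R = b%:R :> R.
  rewrite sumr_const card_ffun card_bool card_ord -[LHS]mulr_natl natrX mulrA.
  by rewrite mulfV ?mul1r// expf_neq0.
have cst1 : \sum_(t : {ffun 'I_N -> bool}) 2 ^- N = 1 :> R.
  by rewrite -[RHS](cst true); apply: eq_bigr => t _; rewrite mulr1.
rewrite /sc_decision iA /= /wrong.
case: (u 0 i) => /=;
  case: (ltgtP (bit_likelihood i y u true)
               (bit_likelihood i y u false)) => _ /=;
  by rewrite ?coin_average /= ?mulr0n ?mulr1n ?mulr0 ?mulr1 ?addr0 ?add0r
    ?cst1 ?big1_eq.
Qed.

(** A message is determined by its support, a subset of [A]. *)
Lemma card_messages : (#|[pred u | is_message A u]| <= 2 ^ #|A|)%N.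
Proof.
rewrite -card_powerset.
rewrite -(card_in_imset (f := fun u : 'rV[bool]_N => finset (fun i => u 0 i))).
  apply: subset_leq_card; apply/fintype.subsetP => _ /imsetP[u /forallP mu ->].
  rewrite inE; apply/fintype.subsetP => i; rewrite inE => ui.
  by apply: contraLR ui; have := mu i; case: (_ \in _).
move=> u w _ _ /setP uw; apply/rowP => i.
by have := uw i; rewrite !inE.
Qed.

(** By [sc_decode_correct], a block error forces an error of some decision made from the true
    previous bits. A union bound over [A] follows, each term being evaluated by
    [esum_genie_error]. *)
Lemma sc_block_error_le :
  (sc_block_error W A <= \sum_(i in A) (error_prob (bit_channel W i))%:E)%E.
Proof.
set S := (\sum_(i in A) _)%E.
have E0 i : (0 <= (error_prob (bit_channel W i))%:E)%E.
  rewrite -(esum_genie_error i 0) esum_ge0// => y _.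
  by rewrite lee_fin genie_error_ge0.
have S0 : (0 <= S)%E by exact: sume_ge0.
set a : R := 2 ^- #|A|; set b : R := 2 ^- N.
have a0 : 0 <= a by rewrite invr_ge0 exprn_ge0.
have b0 : 0 <= b by rewrite invr_ge0 exprn_ge0.
apply: (@le_trans _ _ (\sum_(u : 'rV[bool]_N | is_message A u) a%:E * S)%E).
  apply: lee_sum => u mu.
  under eq_bigr => t _.
    rewrite -ge0_esumZl ?mulr_ge0//; last first.
      by move=> y; rewrite lee_fin mulr_ge0 ?likelihood_ge0.
    over.
  rewrite -esum_sum; last first.
    by move=> y t _ _; rewrite -EFinM lee_fin !mulr_ge0 ?likelihood_ge0.
  have -> : (a%:E * S = \esum_(y in [set: {ffun 'I_N -> output W}])
      \sum_(i in A) (a * genie_error i y u)%:E)%E.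
    rewrite esum_sum; last first.
      by move=> y i _ _; rewrite lee_fin mulr_ge0 ?genie_error_ge0.
    rewrite ge0_sume_distrr//; apply: eq_bigr => i _.
    rewrite -(esum_genie_error i u) -ge0_esumZl//.
    by move=> y; rewrite lee_fin genie_error_ge0.
  apply: le_esum => y _.
  under eq_bigr do rewrite -EFinM.
  rewrite !sumEFin lee_fin.
  (* Expressing [wrong] again as an average over the coins allows a comparison for each fixed
     [t]. *)
  under [leRHS]eq_bigr do
    rewrite /genie_error mulrCA -decision_average// mulr_sumr mulr_sumr.
  rewrite [leRHS]exchange_big /=; apply: ler_sum => t _.
  have term_ge0 i :
      0 <= likelihood y u * (a * (b * (sc_decision A y t u i != u 0 i)%:R)).
    by rewrite !mulr_ge0 ?likelihood_ge0.
  case: (eqVneq (sc_decode A y t) u) => [_|ne].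
    by rewrite !mulr0 sumr_ge0.
  have [i iA di] : exists2 i, i \in A & sc_decision A y t u i != u 0 i.
    apply/exists_inP; apply: contra_neqT ne.
    rewrite negb_exists_in => /forall_inP ok.
    apply: sc_decode_correct => // i iA; apply/eqP.
    by have := ok i iA; rewrite negbK.
  rewrite (bigD1 i)//= di !mulr1 mulrC -[leLHS]addr0 lerD// ?sumr_ge0//.
rewrite -ge0_sume_distrl// sumEFin sumr_const.
apply: (@le_trans _ _ (1%:E * S)%E); last by rewrite mul1e.
rewrite lee_wpmul2r// lee_fin -[leLHS]mulr_natl ler_pdivrMr ?exprn_gt0// mul1r.
by rewrite -natrX ler_nat card_messages.
Qed.

End ErrorAnalysis.

(** * Quality of the selected indices *)

Section GoodIndices.
Context {R : realType}.

Lemma sum_binary n (f : seq bool -> R) :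
  \sum_(i < 2 ^ n) f (binary n i) = (2 ^ n)%:R * avg n f.
Proof.
elim: n f => [|n IH] f; first by rewrite big_ord1 mul1r.
have half b : \sum_(k < 2 ^ n) f (binary n.+1 (half_index b k)) =
    (2 ^ n)%:R * avg n (fun s => f (b :: s)).
  by rewrite -IH; apply: eq_bigr => k _; rewrite binary_half_index.
by rewrite big_half_index !half expnS natrM /=; field.
Qed.

(** The set [G] of indices with error at most [e] has at least as many elements as [A]. If some
    index of [A] were not in [G], the minimality of [A] would force all of [G] into [A], strictly,
    against the cardinals. *)
Lemma info_set_error_le (W : channel R) n (r e : R) (A : {set 'I_(2 ^ n)}) :
  r <= avg n (fun s => (error_prob (polarized W s) <= e)%R%:R) ->
  is_info_set W r A -> forall i, i \in A -> error_prob (bit_channel W i) <= e.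
Proof.
move=> good [cardA minA] i iA; rewrite leNgt; apply/negP => ei.
pose G := [set j : 'I_(2 ^ n) | error_prob (bit_channel W j) <= e].
have AG : (#|A| <= #|G|)%N.
  rewrite -lez_nat cardA ceil_le_int -pmulrn.
  have -> : #|G|%:R =
      \sum_(j < 2 ^ n) (error_prob (bit_channel W j) <= e)%R%:R :> R.
    rewrite -sum1_card natr_sum big_mkcond; apply: eq_bigr => j _.
    by rewrite inE; case: (_ <= _).
  rewrite (sum_binary n (fun s => (error_prob (polarized W s) <= e)%R%:R)).
  by rewrite ler_wpM2l.
have : G \proper A.
  apply/properP; split; last by exists i; rewrite // inE -ltNge.
  apply/fintype.subsetP => j; rewrite inE => ej; apply: contraLR ei => jA.
  by rewrite -leNgt (le_trans (minA _ _ iA jA)).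
by move/proper_card; rewrite ltnNge AG.
Qed.

End GoodIndices.

(** * Block-length needed at a given gap to capacity *)

Theorem theorem18 (R : realType) (alpha beta rho Pe : R)
  (alpha_gt0 : 0 < alpha) (beta_gt0 : 0 < beta) (rho_gt0 : 0 < rho)
  (alpha_lt1 : alpha < 1) (Pe_gt0 : 0 < Pe) :
  exists c : R, 0 < c /\
    forall W : channel R, is_BMS W ->
    (forall n : nat,
       coin_expectation (fun b : n.-tuple bool =>
         (bhattacharyya_process W b * (1 - bhattacharyya_process W b))
           `^ alpha)
       <= beta * 2 `^ (- (rho * n%:R))) ->
    forall r : R, 0 < r -> r < capacity W ->
    let d := capacity W - r in
    exists n : nat,
      log2 (2 ^ n)%:R <= (1 + rho^-1) * log2 d^-1
                          + c * (log2 (log2 (4 / d))) ^+ 2 /\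
      forall A : {set 'I_(2 ^ n)}, is_info_set W r A ->
        (sc_block_error W A <= Pe%:E)%E.
Proof.
have [c c0 speed] := polarization_speed alpha_gt0 beta_gt0 rho_gt0 Pe_gt0.
exists c; split=> // W bW H r r0 rW d.
have d01 : 0 < d < 1.
  by rewrite subr_gt0 rW /=; have := capacity_le1 bW; rewrite /d; lra.
have [|n [nle good]] := speed W bW _ d d01.
  by move=> n; rewrite -coin_expectationE; exact: H.
exists n; split; first by rewrite natrX log2X// log2_2 mulr1.
move=> A infoA; apply: le_trans (sc_block_error_le bW A) _.
have E i : i \in A -> error_prob (bit_channel W i) <= Pe / (2 ^ n)%:R.
  apply: info_set_error_le infoA i.
  (* As [capacity W - d] is [r], the proportion of indices with Z <= Pe / N is at least the rate,
     and E <= Z. *)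
  rewrite subKr in good; apply: le_trans good _; apply: le_avg => s _.
  rewrite ler_nat; case: leP => // zs.
  by rewrite (le_trans (error_prob_le_bhattacharyya (polarized_BMS s bW))).
have N0 : 0 < (2 ^ n)%:R :> R by rewrite ltr0n expn_gt0.
rewrite sumEFin lee_fin; apply: le_trans (ler_sum _ E) _.
rewrite sumr_const -[leLHS]mulr_natl mulrA ler_pdivrMr// mulrC ler_pM2l//.
rewrite ler_nat.
by rewrite -[leqRHS]card_ord max_card.
Qed.
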